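(* Suppose that $R$ is a left pure-semisimple and Quasi-Frobenius ring. Then the functor $$\Im:\mathcal{F}(R\text{-}\mathrm{Mod})\longrightarrow(\underline{\mathrm{mod}}\text{-}R,\mathcal{A}b),\qquad \Im(Y\xrightarrow{g}Z)=j_\rho\big(\mathrm{Ker}(-\otimes Y\xrightarrow{-\otimes g}-\otimes Z)\big),$$ is full, dense and objective.
   Context: A ring is Quasi-Frobenius (QF) if it is left and right artinian and left and right self-injective; it is left pure-semisimple if every left $R$-module is pure-injective. $R\text{-}\mathrm{Mod}$ is the category of all left $R$-modules, $\mathrm{mod}\text{-}R$ the category of finitely presented right $R$-modules, $\underline{\mathrm{mod}}\text{-}R$ its stable category modulo projectives, $\otimes=\otimes_R$. $(\mathrm{mod}\text{-}R,\mathcal{A}b)$ is the category of additive covariant functors $\mathrm{mod}\text{-}R\to\mathcal{A}b$ (abelian groups); $(\underline{\mathrm{mod}}\text{-}R,\mathcal{A}b)$ is identified with its full subcategory of functors vanishing on projective modules, with inclusion functor $j$. For a left $R$-module $M$, $-\otimes M$ is regarded as an object of $(\mathrm{mod}\text{-}R,\mathcal{A}b)$. The morphism category $\mathcal{H}(R\text{-}\mathrm{Mod})$ has as objects the morphisms of $R\text{-}\mathrm{Mod}$ and as morphisms the commutative squares; $\mathcal{F}(R\text{-}\mathrm{Mod})$ is its full subcategory of all epimorphisms. $j_\rho:(\mathrm{mod}\text{-}R,\mathcal{A}b)\to(\underline{\mathrm{mod}}\text{-}R,\mathcal{A}b)$ is the right adjoint of the inclusion $j$. $\Im$ is the composite of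 the inclusion $\mathcal{F}(R\text{-}\mathrm{Mod})\hookrightarrow\mathcal{H}(R\text{-}\mathrm{Mod})$, the functor $\Sigma':(X\xrightarrow{f}Y)\mapsto\mathrm{Ker}(-\otimes f)$, and $j_\rho$. Explicitly, on objects: given an epimorphism $g:Y\to Z$ with kernel $f:X\to Y$, choose a monomorphism $\iota:X\to I$ with $I$ injective and $s:Y\to I$ with $sf=\iota$; then $\Im(g)$ is the kernel of $-\otimes Y\to-\otimes(Z\oplus I)$ induced by $\begin{bmatrix}g\\ s\end{bmatrix}:Y\to Z\oplus I$ (independent of choices). An additive functor $F:\mathcal{X}\to\mathcal{Y}$ between additive categories is objective if every morphism $h$ of $\mathcal{X}$ with $F(h)=0$ factors through an object $K$ with $F(K)=0$. Dense means essentially surjective on objects. *)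

(* Defs.v *)
From HB Require Import structures.
From mathcomp Require Import all_boot all_order all_algebra.
From mathcomp Require Import ring_quotient.
From mathcomp Require Import boolp.
From mathcomp.multinomials Require Import freeg.

Set Implicit Arguments.
Unset Strict Implicit.
Unset Printing Implicit Defensive.

Import GRing.Theory.
Local Open Scope ring_scope.
Local Open Scope quotient_scope.

(* The abelian group structure on hom x y is given by bare operations and not *)
(* by a zmodType: the hom-sets of a functor category with large source live   *)
(* in a larger universe than the carriers of zmodTypes.                       *)
Record preadditive := Preadditive {
  obj :> Type;
  hom : obj -> obj -> Type;
  idm : forall x, hom x x;
  comp : forall x y z, hom y z -> hom x y -> hom x z;
  hom0 : forall x y, hom x y;
  hom_opp : forall x y, hom x y -> hom x y;
  hom_add : forall x y, hom x y -> hom x y -> hom x y;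
  compA : forall x y z t (h : hom z t) (g : hom y z) (f : hom x y),
    comp h (comp g f) = comp (comp h g) f;
  comp1m : forall x y (f : hom x y), comp (idm y) f = f;
  compm1 : forall x y (f : hom x y), comp f (idm x) = f;
  hom_addA : forall x y, associative (@hom_add x y);
  hom_addC : forall x y, commutative (@hom_add x y);
  hom_add0 : forall x y, left_id (hom0 x y) (@hom_add x y);
  hom_addN : forall x y, left_inverse (hom0 x y) (@hom_opp x y) (@hom_add x y);
  comp_addl : forall x y z (g g' : hom y z) (f : hom x y),
    comp (hom_add g g') f = hom_add (comp g f) (comp g' f);
  comp_addr : forall x y z (g : hom y z) (f f' : hom x y),
    comp g (hom_add f f') = hom_add (comp g f) (comp g f')
}.
Arguments idm {p} x.
Arguments comp {p x y z} _ _.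
Arguments hom0 {p} x y.
Arguments hom_opp {p x y} _.
Arguments hom_add {p x y} _ _.

Record functor (C D : preadditive) := Functor {
  fobj :> C -> D;
  fmap : forall x y : C, hom x y -> hom (fobj x) (fobj y);
  fmap1 : forall x : C, fmap (idm x) = idm (fobj x);
  fmapM : forall (x y z : C) (g : hom y z) (f : hom x y),
    fmap (comp g f) = comp (fmap g) (fmap f);
  fmapD : forall (x y : C) (f g : hom x y),
    fmap (hom_add f g) = hom_add (fmap f) (fmap g)
}.
Arguments fmap {C D} _ {x y} _.

Definition comp_functor (C D E : preadditive) (G : functor D E)
  (F : functor C D) : functor C E.
Proof.
by refine (@Functor C E (fun x => G (F x)) (fun x y f => fmap G (fmap F f))
             _ _ _) => *; rewrite ?fmap1 ?fmapM ?fmapD.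
Defined.

Record nat_trans (C D : preadditive) (F G : functor C D) := NatTrans {
  ntr :> forall x : C, hom (F x) (G x);
  ntr_nat : forall (x y : C) (f : hom x y),
    comp (ntr y) (fmap F f) = comp (fmap G f) (ntr x)
}.

Lemma nat_trans_eq (C D : preadditive) (F G : functor C D)
  (a b : nat_trans F G) : (forall x, a x = b x) -> a = b.
Proof.
case: a b => [a Ha] [b Hb] /= ab.
have {}ab : a = b by apply: functional_extensionality_dep.
by case: _ / ab in Hb *; congr NatTrans; apply: Prop_irrelevance.
Qed.

Section HomTheory.
Variable C : preadditive.
Implicit Types x y z : C.

Lemma hom_addI x y (f g h : hom x y) : hom_add f g = hom_add f h -> g = h.
Proof.
by move=> e; rewrite -(hom_add0 g) -(hom_add0 h) -(hom_addN f) -!hom_addA e.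
Qed.

Lemma comp0m x y z (f : hom x y) : comp (hom0 y z) f = hom0 x z.
Proof.
apply: (@hom_addI _ _ (comp (hom0 y z) f)).
by rewrite -comp_addl hom_add0 hom_addC hom_add0.
Qed.

Lemma compm0 x y z (f : hom y z) : comp f (hom0 x y) = hom0 x z.
Proof.
apply: (@hom_addI _ _ (comp f (hom0 x y))).
by rewrite -comp_addr hom_add0 hom_addC hom_add0.
Qed.

Lemma compNm x y z (g : hom y z) (f : hom x y) :
  comp (hom_opp g) f = hom_opp (comp g f).
Proof.
apply: (@hom_addI _ _ (comp g f)).
by rewrite -comp_addl hom_addC hom_addN comp0m hom_addC hom_addN.
Qed.

Lemma compmN x y z (g : hom y z) (f : hom x y) :
  comp g (hom_opp f) = hom_opp (comp g f).
Proof.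
apply: (@hom_addI _ _ (comp g f)).
by rewrite -comp_addr hom_addC hom_addN compm0 hom_addC hom_addN.
Qed.

Definition is_iso x y (f : hom x y) :=
  exists g : hom y x, comp g f = idm x /\ comp f g = idm y.

Definition is_epi x y (f : hom x y) :=
  forall z (u v : hom y z), comp u f = comp v f -> u = v.

(* both initial and terminal: hom0 is then the only morphism *)
Definition is_zero x :=
  forall y, (forall f : hom x y, f = hom0 x y) /\
            (forall f : hom y x, f = hom0 y x).

End HomTheory.

Lemma fmap0 (C D : preadditive) (F : functor C D) (x y : C) :
  fmap F (hom0 x y) = hom0 (F x) (F y).
Proof.
apply: (@hom_addI _ _ _ (fmap F (hom0 x y))).
by rewrite -fmapD hom_add0 hom_addC hom_add0.
Qed.

Section FunctorProperties.
Variables (C D : preadditive).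

Definition full (F : functor C D) :=
  forall (x y : C) (h : hom (F x) (F y)), exists f : hom x y, fmap F f = h.

Definition dense (F : functor C D) :=
  forall y : D, exists (x : C) (f : hom (F x) y), is_iso f.

Definition objective (F : functor C D) :=
  forall (x y : C) (h : hom x y), fmap F h = hom0 (F x) (F y) ->
  exists (K : C) (a : hom x K) (b : hom K y), is_zero (F K) /\ h = comp b a.

Definition right_adjoint (F : functor C D) (G : functor D C) :=
  exists phi : forall (c : C) (d : D), hom (F c) d -> hom c (G d),
    [/\ forall c d, bijective (@phi c d),
        forall (c c' : C) (d : D) (f : hom c' c) (h : hom (F c) d),
          phi c' d (comp h (fmap F f)) = comp (phi c d h) f
      & forall (c : C) (d d' : D) (g : hom d d') (h : hom (F c) d),
          phi c d' (comp g h) = comp (fmap G g) (phi c d h)].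

End FunctorProperties.

Definition full_sub (C : preadditive) (P : C -> Prop) : preadditive.
Proof.
refine (@Preadditive {x : C | P x} (fun x y => hom (sval x) (sval y))
  (fun x => idm (sval x)) (fun x y z g f => comp g f)
  (fun x y => hom0 (sval x) (sval y))
  (fun x y f => hom_opp f) (fun x y f g => hom_add f g) _ _ _ _ _ _ _ _ _) => *.
- exact: compA.
- exact: comp1m.
- exact: compm1.
- by move=> ? ? ?; apply: hom_addA.
- by move=> ? ?; apply: hom_addC.
- by move=> ?; apply: hom_add0.
- by move=> ?; apply: hom_addN.
- exact: comp_addl.
- exact: comp_addr.
Defined.

Definition full_sub_incl (C : preadditive) (P : C -> Prop) :
  functor (full_sub P) C.
Proof.
by refine (@Functor (full_sub P) C (fun x => sval x) (fun x y f => f) _ _ _).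
Defined.

Section FunctorCategory.
Variables (C D : preadditive).
Implicit Types F G H : functor C D.

Definition nat_id F : nat_trans F F.
Proof.
by refine (@NatTrans _ _ F F (fun x => idm (F x)) _) => *; rewrite comp1m compm1.
Defined.

Definition nat_comp F G H (b : nat_trans G H) (a : nat_trans F G) :
  nat_trans F H.
Proof.
refine (@NatTrans _ _ F H (fun x => comp (b x) (a x)) _) => x y f.
by rewrite -compA ntr_nat compA ntr_nat compA.
Defined.

Definition nat_0 F G : nat_trans F G.
Proof.
by refine (@NatTrans _ _ F G (fun x => hom0 (F x) (G x)) _) => *;
  rewrite comp0m compm0.
Defined.

Definition nat_opp F G (a : nat_trans F G) : nat_trans F G.
Proof.
by refine (@NatTrans _ _ F G (fun x => hom_opp (a x)) _) => *;
  rewrite compNm compmN ntr_nat.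
Defined.

Definition nat_add F G (a b : nat_trans F G) : nat_trans F G.
Proof.
by refine (@NatTrans _ _ F G (fun x => hom_add (a x) (b x)) _) => *;
  rewrite comp_addl comp_addr !ntr_nat.
Defined.

Definition functor_cat : preadditive.
Proof.
refine (@Preadditive (functor C D) (@nat_trans C D) nat_id nat_comp nat_0
  nat_opp nat_add _ _ _ _ _ _ _ _ _) => *.
- by apply: nat_trans_eq => ? /=; rewrite compA.
- by apply: nat_trans_eq => ? /=; rewrite comp1m.
- by apply: nat_trans_eq => ? /=; rewrite compm1.
- by move=> ? ? ?; apply: nat_trans_eq => ? /=; rewrite hom_addA.
- by move=> ? ?; apply: nat_trans_eq => ? /=; rewrite hom_addC.
- by move=> ?; apply: nat_trans_eq => ? /=; rewrite hom_add0.
- by move=> ?; apply: nat_trans_eq => ? /=; rewrite hom_addN.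
- by apply: nat_trans_eq => ? /=; rewrite comp_addl.
- by apply: nat_trans_eq => ? /=; rewrite comp_addr.
Defined.

End FunctorCategory.

Section MorphismCategory.
Variable C : preadditive.

Record arrow := Arrow { src : C; tgt : C; arr :> hom src tgt }.

Record square (f g : arrow) := Square {
  sq_src : hom (src f) (src g);
  sq_tgt : hom (tgt f) (tgt g);
  sq_comm : comp sq_tgt f = comp g sq_src
}.

Lemma square_eq (f g : arrow) (s t : square f g) :
  sq_src s = sq_src t -> sq_tgt s = sq_tgt t -> s = t.
Proof.
case: s t => [a b H] [a' b' H'] /= ea eb; case: _ / ea in H' *.
by case: _ / eb in H' *; congr Square; apply: Prop_irrelevance.
Qed.

Definition sq_id (f : arrow) : square f f.
Proof. by exists (idm _) (idm _); rewrite comp1m compm1. Defined.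

Definition sq_comp (f g h : arrow) (t : square g h) (s : square f g) :
  square f h.
Proof.
exists (comp (sq_src t) (sq_src s)) (comp (sq_tgt t) (sq_tgt s)).
by rewrite -compA sq_comm compA sq_comm compA.
Defined.

Definition sq_0 (f g : arrow) : square f g.
Proof. by exists (hom0 _ _) (hom0 _ _); rewrite comp0m compm0. Defined.

Definition sq_opp (f g : arrow) (s : square f g) : square f g.
Proof.
by exists (hom_opp (sq_src s)) (hom_opp (sq_tgt s)); rewrite compNm compmN sq_comm.
Defined.

Definition sq_add (f g : arrow) (s t : square f g) : square f g.
Proof.
exists (hom_add (sq_src s) (sq_src t)) (hom_add (sq_tgt s) (sq_tgt t)).
by rewrite comp_addl comp_addr !sq_comm.
Defined.

Definition mor_cat : preadditive.
Proof.
refine (@Preadditive arrow square sq_id sq_comp sq_0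
  sq_opp sq_add _ _ _ _ _ _ _ _ _) => *.
- by apply: square_eq => /=; rewrite compA.
- by apply: square_eq => /=; rewrite comp1m.
- by apply: square_eq => /=; rewrite compm1.
- by move=> ? ? ?; apply: square_eq => /=; rewrite hom_addA.
- by move=> ? ?; apply: square_eq => /=; rewrite hom_addC.
- by move=> ?; apply: square_eq => /=; rewrite hom_add0.
- by move=> ?; apply: square_eq => /=; rewrite hom_addN.
- by apply: square_eq => /=; rewrite comp_addl.
- by apply: square_eq => /=; rewrite comp_addr.
Defined.

Definition epi_cat : preadditive :=
  @full_sub mor_cat (fun f : arrow => is_epi f).

Definition epi_incl : functor epi_cat mor_cat := full_sub_incl _.

End MorphismCategory.

Definition mor_map (C D : preadditive) (F : functor C D) :
  functor (mor_cat C) (mor_cat D).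
Proof.
refine (@Functor (mor_cat C) (mor_cat D) (fun f => Arrow (fmap F (arr f)))
  (fun f g s => @Square D (Arrow (fmap F (arr f))) (Arrow (fmap F (arr g)))
                  (fmap F (sq_src s)) (fmap F (sq_tgt s)) _) _ _ _).
- by move=> f; apply: square_eq; rewrite /= fmap1.
- by move=> f g h t s; apply: square_eq; rewrite /= fmapM.
- by move=> f g s t; apply: square_eq; rewrite /= fmapD.
Unshelve.
by rewrite /= -!fmapM sq_comm.
Defined.

Lemma additive_eq (A B : zmodType) (f g : {additive A -> B}) : f =1 g -> f = g.
Proof.
case: f g => [f [[Hf]]] [g [[Hg]]] /= /funext fg; case: _ / fg in Hg *.
by rewrite (Prop_irrelevance Hf Hg).
Qed.

Lemma linear_eq (R : pzRingType) (M N : lmodType R) (f g : {linear M -> N}) :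
  f =1 g -> f = g.
Proof.
case: f g => [f [[Hf] [Kf]]] [g [[Hg] [Kg]]] /= /funext fg.
case: _ / fg in Hg Kg *.
by rewrite (Prop_irrelevance Hf Hg) (Prop_irrelevance Kf Kg).
Qed.

Definition Ab : preadditive.
Proof.
refine (@Preadditive zmodType (fun A B => {additive A -> B})
  (fun A => idfun : {additive A -> A}) (fun A B C g f => g \o f : {additive _ -> _})
  (fun A B => \0%R : {additive A -> B}) (fun A B f => \- f : {additive _ -> _})
  (fun A B f g => f \+ g : {additive _ -> _}) _ _ _ _ _ _ _ _ _) => * //.
- exact: additive_eq.
- exact: additive_eq.
- exact: additive_eq.
- by move=> ? ? ?; apply: additive_eq => ? /=; rewrite addrA.
- by move=> ? ?; apply: additive_eq => ? /=; rewrite addrC.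
- by move=> ?; apply: additive_eq => ? /=; rewrite add0r.
- by move=> ?; apply: additive_eq => ? /=; rewrite addNr.
- exact: additive_eq.
- by apply: additive_eq => ? /=; rewrite raddfD.
Defined.

Definition Mod (R : pzRingType) : preadditive.
Proof.
refine (@Preadditive (lmodType R) (fun M N => {linear M -> N})
  (fun M => idfun : {linear M -> M}) (fun M N P g f => g \o f : {linear _ -> _})
  (fun M N => \0%R : {linear M -> N}) (fun M N f => \- f : {linear _ -> _})
  (fun M N f g => f \+ g : {linear _ -> _}) _ _ _ _ _ _ _ _ _) => *.
- exact: linear_eq.
- exact: linear_eq.
- exact: linear_eq.
- by move=> ? ? ?; apply: linear_eq => ? /=; rewrite addrA.
- by move=> ? ?; apply: linear_eq => ? /=; rewrite addrC.
- by move=> ?; apply: linear_eq => ? /=; rewrite add0r.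
- by move=> ?; apply: linear_eq => ? /=; rewrite addNr.
- exact: linear_eq.
- by apply: linear_eq => ? /=; rewrite linearD.
Defined.

Record subgroup (A : zmodType) := Subgroup {
  sg_mem :> A -> Prop;
  sg_mem0 : sg_mem 0;
  sg_memB : forall x y, sg_mem x -> sg_mem y -> sg_mem (x - y)
}.

Section Subgroup.
Variables (A : zmodType) (S : subgroup A).

Lemma sg_memN x : S x -> S (- x).
Proof. by rewrite -(sub0r x) => Sx; apply: sg_memB => //; apply: sg_mem0. Qed.

Lemma sg_memD x y : S x -> S y -> S (x + y).
Proof. by rewrite -{2}(opprK y) => Sx /sg_memN; apply: sg_memB. Qed.

Definition sg_pred : {pred A} := fun x => `[< S x >].

Fact sg_pred_closed : zmod_closed sg_pred.
Proof.
by split=> [|x y /asboolP Sx /asboolP Sy]; apply/asboolP;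
  [apply: sg_mem0 | apply: sg_memB].
Qed.
HB.instance Definition _ := GRing.isZmodClosed.Build A sg_pred sg_pred_closed.

Record sg_type := SgType { sg_val : A; sg_valP : sg_val \in sg_pred }.
HB.instance Definition _ := [isSub for sg_val].
HB.instance Definition _ := [Choice of sg_type by <:].
HB.instance Definition _ := [SubChoice_isSubZmodule of sg_type by <:].

Lemma sg_valS (x : sg_type) : S (val x).
Proof. by case: x => x /= /asboolP. Qed.

Definition sg_in (x : A) (Sx : S x) : sg_type := SgType (asboolT Sx).

Definition sg_quot : zmodType := Quotient.quot sg_pred.

Definition sg_pi : {additive A -> sg_quot} := \pi_(Quotient.quot sg_pred).

Lemma sg_pi_eq0 x : sg_pi x = 0 <-> S x.
Proof.
rewrite -[0](raddf0 sg_pi) /sg_pi /=; split.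
  by move/eqP; rewrite -Quotient.idealrBE subr0 => /asboolP.
by move=> Sx; apply/eqP; rewrite -Quotient.idealrBE subr0; apply/asboolP.
Qed.

Lemma sg_pi_surj (q : sg_quot) : exists x, sg_pi x = q.
Proof. by exists (repr q); rewrite /sg_pi /= reprK. Qed.

End Subgroup.

Section SubgroupMaps.
Variables (A B : zmodType) (f : {additive A -> B}).

Section Restrict.
Variables (S : subgroup A) (T : subgroup B) (fS : forall x, S x -> T (f x)).

Definition sg_map_fun (x : sg_type S) : sg_type T := sg_in (fS (sg_valS x)).

Fact sg_map_is_zmod_morphism : zmod_morphism sg_map_fun.
Proof. by move=> x y; apply: val_inj; rewrite /= raddfB. Qed.
HB.instance Definition _ :=
  GRing.isZmodMorphism.Build _ _ sg_map_fun sg_map_is_zmod_morphism.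

Definition sg_map : {additive sg_type S -> sg_type T} := sg_map_fun.
End Restrict.

Section Corestrict.
Variables (T : subgroup B) (fT : forall x, T (f x)).

Definition sg_cores_fun (x : A) : sg_type T := sg_in (fT x).

Fact sg_cores_is_zmod_morphism : zmod_morphism sg_cores_fun.
Proof. by move=> x y; apply: val_inj; rewrite /= raddfB. Qed.
HB.instance Definition _ :=
  GRing.isZmodMorphism.Build _ _ sg_cores_fun sg_cores_is_zmod_morphism.

Definition sg_cores : {additive A -> sg_type T} := sg_cores_fun.
End Corestrict.

Section Factor.
Variables (S : subgroup A) (fS : forall x, S x -> f x = 0).

Definition sg_lift_fun (q : sg_quot S) : B := f (repr q).

Lemma sg_lift_funE x : sg_lift_fun (sg_pi S x) = f x.
Proof.
apply/eqP; rewrite -subr_eq0 -raddfB; apply/eqP/fS/(sg_pi_eq0 S).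
by rewrite raddfB {1}/sg_pi /= reprK subrr.
Qed.

Fact sg_lift_is_zmod_morphism : zmod_morphism sg_lift_fun.
Proof.
move=> p q; have [x <-] := sg_pi_surj p; have [y <-] := sg_pi_surj q.
by rewrite -raddfB !sg_lift_funE raddfB.
Qed.
HB.instance Definition _ :=
  GRing.isZmodMorphism.Build _ _ sg_lift_fun sg_lift_is_zmod_morphism.

Definition sg_lift : {additive sg_quot S -> B} := sg_lift_fun.

Lemma sg_liftE x : sg_lift (sg_pi S x) = f x.
Proof. exact: sg_lift_funE. Qed.
End Factor.

Definition ker_subgroup : subgroup A.
Proof.
exists (fun x => f x = 0); first exact: raddf0.
by move=> x y fx fy; rewrite raddfB fx fy subrr.
Defined.

End SubgroupMaps.

Definition gen_subgroup (A : zmodType) (E : A -> Prop) : subgroup A.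
Proof.
exists (fun x => forall S : subgroup A, (forall y, E y -> S y) -> S x).
  by move=> S _; apply: sg_mem0.
by move=> x y Ex Ey S ES; apply: sg_memB; [apply: Ex | apply: Ey].
Defined.

Definition subfunctor (C : preadditive) (F : functor C Ab)
  (S : forall x : C, subgroup (F x))
  (SF : forall (x y : C) (f : hom x y) t, S x t -> S y (fmap F f t)) :
  functor C Ab.
Proof.
refine (@Functor C Ab (fun x => sg_type (S x) : zmodType)
  (fun x y f => sg_map (SF x y f)) _ _ _).
- by move=> x; apply: additive_eq => t; apply: val_inj; rewrite /= fmap1.
- by move=> x y z g f; apply: additive_eq => t; apply: val_inj; rewrite /= fmapM.
- by move=> x y f g; apply: additive_eq => t; apply: val_inj; rewrite /= fmapD.
Defined.

Section KernelFunctor.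
Variable C : preadditive.

Section Object.
Variable a : mor_cat (functor_cat C Ab).

Lemma ker_fmap (x y : C) (f : hom x y) t :
  ker_subgroup (arr a x) t -> ker_subgroup (arr a y) (fmap (src a) f t).
Proof.
move=> /= at0; have := congr1 (fun h : {additive _ -> _} => h t) (ntr_nat (arr a) f).
by rewrite /= => ->; rewrite at0 raddf0.
Qed.

Definition ker_obj : functor C Ab := subfunctor ker_fmap.
End Object.

Lemma ker_mor_subproof (a b : mor_cat (functor_cat C Ab)) (s : hom a b) (x : C) t :
  ker_subgroup (arr a x) t -> ker_subgroup (arr b x) (sq_src s x t).
Proof.
move=> /= at0; have := congr1 (fun n : nat_trans _ _ => n x) (sq_comm s).
move/(congr1 (fun h : {additive _ -> _} => h t)) => /= <-.
by rewrite at0 raddf0.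
Qed.

Definition ker_mor (a b : mor_cat (functor_cat C Ab)) (s : hom a b) :
  nat_trans (ker_obj a) (ker_obj b).
Proof.
exists (fun x => sg_map (@ker_mor_subproof a b s x)).
move=> x y f; apply: additive_eq => t; apply: val_inj => /=.
exact: (congr1 (fun h : {additive _ -> _} => h (val t)) (ntr_nat (sq_src s) f)).
Defined.

Definition ker_functor : functor (mor_cat (functor_cat C Ab)) (functor_cat C Ab).
Proof.
refine (@Functor (mor_cat (functor_cat C Ab)) (functor_cat C Ab)
  ker_obj ker_mor _ _ _) => *.
- by apply: nat_trans_eq => x; apply: additive_eq => t; apply: val_inj.
- by apply: nat_trans_eq => x; apply: additive_eq => t; apply: val_inj.
- by apply: nat_trans_eq => x; apply: additive_eq => t; apply: val_inj.
Defined.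

End KernelFunctor.

(* Right R-modules are left modules over the opposite ring. *)
Definition opring (R : pzRingType) : pzRingType := R^c.

Section Tensor.
Variable R : pzRingType.

Section Object.
Variables (M : lmodType (opring R)) (N : lmodType R).

Definition free_ab : zmodType := {freeg (M * N) / int}.

Inductive tensor_rel : free_ab -> Prop :=
| TensorDl m m' n : tensor_rel (<< (m + m', n) >> - << (m, n) >> - << (m', n) >>)
| TensorDr m n n' : tensor_rel (<< (m, n + n') >> - << (m, n) >> - << (m, n') >>)
| TensorM m (r : R) n :
    tensor_rel (<< ((r : opring R) *: m, n) >> - << (m, r *: n) >>).

Definition tensor : zmodType := sg_quot (gen_subgroup tensor_rel).

Definition tens (m : M) (n : N) : tensor := sg_pi _ (<< (m, n) >> : free_ab).

Lemma tens_rel0 t : tensor_rel t -> sg_pi (gen_subgroup tensor_rel) t = 0.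
Proof. by move=> rt; apply/sg_pi_eq0 => S; apply. Qed.

Lemma tensDl m m' n : tens (m + m') n = tens m n + tens m' n.
Proof.
have /tens_rel0 := TensorDl m m' n; rewrite !raddfB /= => /eqP.
by rewrite -addrA -opprD subr_eq0 => /eqP.
Qed.

Lemma tensDr m n n' : tens m (n + n') = tens m n + tens m n'.
Proof.
have /tens_rel0 := TensorDr m n n'; rewrite !raddfB /= => /eqP.
by rewrite -addrA -opprD subr_eq0 => /eqP.
Qed.

Lemma tensM (m : M) (r : R) (n : N) : tens ((r : opring R) *: m) n = tens m (r *: n).
Proof.
by have /tens_rel0 := TensorM m r n; rewrite raddfB /= => /eqP; rewrite subr_eq0 => /eqP.
Qed.

Section Lift.
Variables (A : zmodType) (b : M -> N -> A).

Definition balanced := [/\ forall m m' n, b (m + m') n = b m n + b m' n,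
  forall m n n', b m (n + n') = b m n + b m n'
  & forall m (r : R) n, b ((r : opring R) *: m) n = b m (r *: n)].

Definition free_lift_fun (x : free_ab) : A :=
  fglift (fun mn : M * N => b mn.1 mn.2 : zmodule A) x.

Fact free_lift_is_zmod_morphism : zmod_morphism free_lift_fun.
Proof. exact: (@lift_is_additive int (M * N)%type (zmodule A)). Qed.
HB.instance Definition _ :=
  GRing.isZmodMorphism.Build _ _ free_lift_fun free_lift_is_zmod_morphism.

Lemma free_liftE m n : free_lift_fun << (m, n) >> = b m n.
Proof. by rewrite /free_lift_fun liftU scale1r. Qed.

Hypothesis bb : balanced.

Lemma free_lift_rel0 x :
  gen_subgroup tensor_rel x -> free_lift_fun x = 0.
Proof.
case: bb => bDl bDr bM; move/(_ (ker_subgroup free_lift_fun)); apply=> {}x.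
case=> [m m' n|m n n'|m r n] /=; rewrite !raddfB /= !free_liftE.
- by rewrite bDl -addrA -opprD subrr.
- by rewrite bDr -addrA -opprD subrr.
- by rewrite bM subrr.
Qed.

Definition tensor_lift : {additive tensor -> A} := sg_lift free_lift_rel0.

Lemma tensor_liftE m n : tensor_lift (tens m n) = b m n.
Proof. by rewrite /tensor_lift sg_liftE /= free_liftE. Qed.

End Lift.

Lemma tensor_ext (A : zmodType) (f g : {additive tensor -> A}) :
  (forall m n, f (tens m n) = g (tens m n)) -> f = g.
Proof.
move=> fg; apply: additive_eq => q; have [x <-] := sg_pi_surj q.
rewrite -(freeg_sumE x) !raddf_sum /=; apply: eq_bigr => -[m n] _.
by rewrite -[coeff _ _]intz -freegU_mulz !raddfMz /= fg.
Qed.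

End Object.

Section Map.
Variables (M M' : lmodType (opring R)) (N N' : lmodType R).
Variables (f : {linear M -> M'}) (g : {linear N -> N'}).

Fact tensor_map_balanced : balanced (fun m n => tens (f m) (g n)).
Proof.
split=> [m m' n|m n n'|m r n]; first by rewrite linearD tensDl.
  by rewrite linearD tensDr.
by rewrite !linearZZ tensM.
Qed.

Definition tensor_map : {additive tensor M N -> tensor M' N'} :=
  tensor_lift tensor_map_balanced.

Lemma tensor_mapE m n : tensor_map (tens m n) = tens (f m) (g n).
Proof. exact: tensor_liftE. Qed.

End Map.

End Tensor.

(* Prevents /= from unfolding these down to representatives in free_ab. *)
Global Opaque tensor tens tensor_lift tensor_map.

Section Modules.
Variable R : pzRingType.

Definition injective_module (E : lmodType R) :=
  forall (A B : lmodType R) (i : {linear A -> B}) (f : {linear A -> E}),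
    injective i -> exists g : {linear B -> E}, forall x, g (i x) = f x.

Definition projective_module (P : lmodType R) :=
  forall (A B : lmodType R) (p : {linear A -> B}) (f : {linear P -> B}),
    (forall b, exists a, p a = b) ->
    exists g : {linear P -> A}, forall x, p (g x) = f x.

Definition finitely_presented (M : lmodType R) :=
  exists (m n : nat) (g : {linear 'rV[R]_m -> 'rV[R]_n})
         (p : {linear 'rV[R]_n -> M}),
    (forall x, exists v, p v = x) /\
    (forall v, p v = 0 <-> exists u, g u = v).

Definition is_submodule (M : lmodType R) (S : M -> Prop) :=
  S 0 /\ forall (a : R) u v, S u -> S v -> S (a *: u + v).

Definition artinian_module (M : lmodType R) :=
  forall S : nat -> M -> Prop,
    (forall k, is_submodule (S k)) -> (forall k x, S k.+1 x -> S k x) ->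
    exists n, forall k x, (n <= k)%N -> (S k x <-> S n x).

Definition pure_mono (A B : lmodType R) (f : {linear A -> B}) :=
  injective f /\
  forall X : lmodType (opring R), injective (tensor_map (idfun : {linear X -> X}) f).

Definition pure_injective_module (E : lmodType R) :=
  forall (A B : lmodType R) (i : {linear A -> B}) (f : {linear A -> E}),
    pure_mono i -> exists g : {linear B -> E}, forall x, g (i x) = f x.

End Modules.

Definition left_pure_semisimple (R : pzRingType) :=
  forall M : lmodType R, pure_injective_module M.

Definition quasi_frobenius (R : pzRingType) :=
  [/\ artinian_module (R^o : lmodType R),
      artinian_module ((opring R)^o : lmodType (opring R)),
      injective_module (R^o : lmodType R)
    & injective_module ((opring R)^o : lmodType (opring R))].

Section Imfunctor.
Variable R : pzRingType.

Definition fpmod : preadditive := @full_sub (Mod (opring R)) (@finitely_presented (opring R)).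

Definition fpmod_sort (X : fpmod) : lmodType (opring R) := sval X.

Definition fpmod_Ab : preadditive := functor_cat fpmod Ab.

Definition vanishes_on_projectives (F : functor fpmod Ab) :=
  forall P : fpmod, projective_module (fpmod_sort P) -> is_zero (F P).

(* The functor category on the stable category of mod-R, identified with the  *)
(* full subcategory of the functors on mod-R that vanish on projectives.      *)
Definition stable_Ab : preadditive := @full_sub fpmod_Ab vanishes_on_projectives.

Definition stable_incl : functor stable_Ab fpmod_Ab := full_sub_incl _.

Definition tensor_obj (M : lmodType R) : functor fpmod Ab.
Proof.
refine (@Functor fpmod Ab (fun X => tensor (fpmod_sort X) M)
  (fun X Y f => tensor_map (f : {linear fpmod_sort X -> fpmod_sort Y}) idfun) _ _ _) => *.
- by apply: tensor_ext => x m; apply: tensor_mapE.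
- by apply: tensor_ext => x m; rewrite /= !tensor_mapE.
- by apply: tensor_ext => x m; rewrite /= !tensor_mapE /= tensDl.
Defined.

Definition tensor_nat (M N : lmodType R) (f : {linear M -> N}) :
  nat_trans (tensor_obj M) (tensor_obj N).
Proof.
exists (fun X : fpmod =>
  tensor_map (idfun : {linear fpmod_sort X -> fpmod_sort X}) f) => X Y g.
by apply: tensor_ext => x m; rewrite /= !tensor_mapE.
Defined.

Definition tensor_functor : functor (Mod R) fpmod_Ab.
Proof.
refine (@Functor (Mod R) fpmod_Ab tensor_obj tensor_nat _ _ _) => *;
  apply: nat_trans_eq => X; apply: tensor_ext => x m.
- by rewrite /= tensor_mapE.
- by rewrite /= !tensor_mapE.
- by rewrite /= !tensor_mapE /= tensDr.
Defined.

Definition Sigma' : functor (mor_cat (Mod R)) fpmod_Ab :=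
  comp_functor (@ker_functor fpmod) (mor_map tensor_functor).

Definition Im_functor (jrho : functor fpmod_Ab stable_Ab) :
  functor (epi_cat (Mod R)) stable_Ab :=
  comp_functor jrho (comp_functor Sigma' (epi_incl (Mod R))).

(* The right adjoint of stable_incl exists: it sends F to its largest         *)
(* subfunctor vanishing on projectives.                                       *)
Section Coreflection.
Variable F : functor fpmod Ab.

Definition stable_part (X : fpmod) : subgroup (F X).
Proof.
exists (fun t => forall (P : fpmod) (h : hom X P),
  projective_module (fpmod_sort P) -> fmap F h t = 0).
  by move=> P h _; apply: raddf0.
by move=> x y Sx Sy P h pP; rewrite raddfB Sx // Sy // subr0.
Defined.

Lemma stable_part_fmap (X Y : fpmod) (f : hom X Y) t :
  stable_part X t -> stable_part Y (fmap F f t).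
Proof.
move=> St P h pP.
exact: etrans (esym (congr1 (fun k : {additive _ -> _} => k t) (fmapM F h f)))
  (St P _ pP).
Qed.

Definition stable_part_functor : functor fpmod Ab := subfunctor stable_part_fmap.

Lemma stable_part_vanishes : vanishes_on_projectives stable_part_functor.
Proof.
move=> P pP A.
have t0 (t : sg_type (stable_part P)) : t = 0.
  apply: val_inj => /=; have := sg_valS t P (idm P) pP.
  by rewrite fmap1.
split=> f; apply: additive_eq => t /=; last exact: t0.
by rewrite (t0 t) raddf0.
Qed.

End Coreflection.

Lemma stable_part_nat (F G : functor fpmod Ab) (a : nat_trans F G) (X : fpmod) t :
  stable_part F X t -> stable_part G X (a X t).
Proof.
move=> St P h pP; have := congr1 (fun k : {additive _ -> _} => k t) (ntr_nat a h).
by rewrite /= => <-; rewrite St // raddf0.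
Qed.

Definition stable_part_mor (F G : functor fpmod Ab) (a : nat_trans F G) :
  nat_trans (stable_part_functor F) (stable_part_functor G).
Proof.
exists (fun X => sg_map (@stable_part_nat F G a X)).
move=> X Y f; apply: additive_eq => t; apply: val_inj => /=.
exact: (congr1 (fun h : {additive _ -> _} => h (val t)) (ntr_nat a f)).
Defined.

Definition stable_coreflection : functor fpmod_Ab stable_Ab.
Proof.
refine (@Functor fpmod_Ab stable_Ab
  (fun F => exist _ (stable_part_functor F) (@stable_part_vanishes F))
  stable_part_mor _ _ _) => *;
by apply: nat_trans_eq => x; apply: additive_eq => t; apply: val_inj.
Defined.

Lemma stable_coreflectionP : right_adjoint stable_incl stable_coreflection.
Proof.
have HS (F : stable_Ab) (G : functor fpmod Ab) (a : nat_trans (sval F) G) X t :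
  stable_part G X (a X t).
  move=> P h pP; have [_ /(_ (idm _))] := svalP F P pP (sval F P).
  move/(congr1 (fun k : {additive _ -> _} => k (fmap (sval F) h t))) => /= t0.
  have := congr1 (fun k : {additive _ -> _} => k t) (ntr_nat a h).
  by rewrite /= => <-; rewrite t0 raddf0.
have @phi (F : stable_Ab) (G : fpmod_Ab) (a : hom (stable_incl F) G) :
    hom F (stable_coreflection G).
  exists (fun X : fpmod => sg_cores (HS F G a X)) => X Y f.
  apply: additive_eq => t; apply: val_inj => /=.
  exact: (congr1 (fun k : {additive _ -> _} => k t) (ntr_nat a f)).
have @psi (F : stable_Ab) (G : fpmod_Ab) (b : hom F (stable_coreflection G)) :
    hom (stable_incl F) G.
  exists (fun X => (val : {additive sg_type (stable_part G X) -> G X}) \o b X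
            : {additive _ -> _}) => X Y f.
  apply: additive_eq => t /=.
  exact: (congr1 (fun k : {additive _ -> _} => val (k t)) (ntr_nat b f)).
exists phi; split=> [F G|F F' G f h|F G G' g h].
- exists (@psi F G) => a; apply: nat_trans_eq => X; apply: additive_eq => t //.
  exact: val_inj.
- by apply: nat_trans_eq => X; apply: additive_eq => t; apply: val_inj.
- by apply: nat_trans_eq => X; apply: additive_eq => t; apply: val_inj.
Qed.

End Imfunctor.

(* Main.v *)
From HB Require Import structures.
From mathcomp Require Import all_boot all_algebra boolp classical_sets functions.
Require Import Defs.

(* For a surjection g : Y -> Z and an embedding s of Y in a product I of      *)
(* copies of R, a tensor of X and Y lies in Im(g)(X) iff it is killed by both *)
(* g and s: tensors over X with coefficients in I are separated by maps from  *)
(* X to R (R is a cogenerator), and finitely presented projectives are flat.  *)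
(*                                                                            *)
(* Every subfunctor of - tensor M is the kernel of - tensor f for some        *)
(* f : M -> N. Applied to the graph of a transformation from a subfunctor of  *)
(* - tensor P to - tensor M, this yields a module receiving both P and M, the *)
(* latter purely; as pure embeddings split, the transformation extends.       *)
(*                                                                            *)
(* Full: a transformation Im(g) -> Im(g') extends to u : Y -> Y', and g' u    *)
(* factors through (g, s). Its component I -> Z' lifts along g', because I is *)
(* projective; subtracting the lift from u makes it commute with g and g'.    *)
(* Objective: a square (u, v) with Im(u, v) = 0 has u factoring through       *)
(* (g, s), hence factors through the pushout of (g, s) along g, on which Im   *)
(* vanishes. Dense: a functor F embeds in some - tensor B with image the      *)
(* kernel of - tensor f; if F is stable then F = Im(f, p) for any free cover  *)
(* p of the target of f.                                                      *)

Set Implicit Arguments.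
Unset Strict Implicit.
Unset Printing Implicit Defensive.

Import GRing.Theory.
Local Open Scope ring_scope.

(** * Modules *)

(** A right adjoint of the inclusion is unique up to natural isomorphism ([right_adjoint_unique])
    and the three properties are invariant under such isomorphisms, so it suffices to treat the
    largest subfunctor vanishing on projectives, [stable_coreflection]. Over a QF ring, R is a
    cogenerator on both sides; evaluation embeds Y in a product I of copies of R, and [in_Im_ker]
    identifies Im(g) with the kernel of - tensor (g, s), where (g, s) : Y -> Z + I. Modules such as
    I and free modules are [separated]: the functors they represent have zero stable part.

    Pure-semisimplicity acts by splitting pure embeddings ([fin_pure_retract]). Together with
    [subfunctor_kernel] this gives [graph_extend], by which transformations defined on subfunctors
    of tensor functors come from module maps, and [tensor_factor], by which an inclusion of kernels
    of tensor functors becomes a factorization of module maps. It also makes products of copies of R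
    projective ([product_lift]). Fullness and objectivity are then statements about maps factoring
    through (g, s). Density rests on [functor_embedding], which places every functor inside some -
    tensor B. *)

Definition mk_linear (R : pzRingType) (M N : lmodType R) (f : M -> N)
    (f_lin : linear f) : {linear M -> N} :=
  HB.pack f (GRing.isLinear.Build R M N *:%R f f_lin).

(** Two values at the same point differ by a value at 0, so the relation is single-valued and its
    choice function is linear. Maps given on representatives are built this way. *)
Lemma choice_linear (R : pzRingType) (M N : lmodType R) (P : M -> N -> Prop) :
  (forall x, exists y, P x y) ->
  (forall a x x' y y', P x y -> P x' y' -> P (a *: x + x') (a *: y + y')) ->
  (forall y, P 0 y -> y = 0) ->
  exists f : {linear M -> N}, forall x y, P x y <-> y = f x.
Proof.
move=> ex lin uniq0.
have uniq x y y' : P x y -> P x y' -> y = y'.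
  move=> Py Py'; apply/eqP; rewrite -subr_eq0; apply/eqP/uniq0.
  by have := lin (-1) _ _ _ _ Py' Py; rewrite !scaleN1r addNr addrC.
have [f fP] := choice ex.
have f_lin : linear f by move=> a x y; apply: uniq (fP _) _; apply: lin.
exists (mk_linear f_lin) => x y; split=> [Pxy|->]; last exact: fP.
exact: uniq Pxy (fP x).
Qed.

Record submodule (R : pzRingType) (M : lmodType R) := Submodule {
  sm_grp :> subgroup M;
  sm_memZ : forall a x, sm_grp x -> sm_grp (a *: x)
}.

Section Submodule.
Variables (R : pzRingType) (M : lmodType R) (S : submodule M).

Definition sm_type : Type := sg_type S.
HB.instance Definition _ := GRing.Zmodule.on sm_type.

Definition sm_scale (a : R) (x : sm_type) : sm_type :=
  sg_in (sm_memZ a (sg_valS x)).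

Fact sm_scalerA a b x : sm_scale a (sm_scale b x) = sm_scale (a * b) x.
Proof. by apply: val_inj; apply: scalerA. Qed.
Fact sm_scale1r : left_id 1 sm_scale.
Proof. by move=> x; apply: val_inj; apply: scale1r. Qed.
Fact sm_scalerDr : right_distributive sm_scale +%R.
Proof. by move=> a x y; apply: val_inj; apply: scalerDr. Qed.
Fact sm_scalerDl x : {morph sm_scale^~ x : a b / a + b}.
Proof. by move=> a b; apply: val_inj; apply: scalerDl. Qed.
HB.instance Definition _ := GRing.Zmodule_isLmodule.Build R sm_type
  sm_scalerA sm_scale1r sm_scalerDr sm_scalerDl.

Definition sm_in x (Sx : S x) : sm_type := sg_in Sx.

Definition sm_val : {linear sm_type -> M}.
Proof. by refine (mk_linear (f := fun x : sm_type => sg_val x) _). Defined.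

Lemma sm_valP x : S (sm_val x). Proof. exact: sg_valS. Qed.
Lemma sm_val_inj : injective sm_val. Proof. exact: val_inj. Qed.
Lemma sm_valK x (Sx : S x) : sm_val (sm_in Sx) = x. Proof. by []. Qed.

Definition sm_quot : Type := sg_quot S.
HB.instance Definition _ := GRing.Zmodule.on sm_quot.

Fact sm_quot_scale_subproof a x : S x -> sg_pi S (a *: x) = 0.
Proof. by move=> Sx; apply/sg_pi_eq0/sm_memZ. Qed.

Definition sm_quot_scale (a : R) : {additive sg_quot S -> sg_quot S} :=
  sg_lift (f := (sg_pi S \o (fun x => a *: x)) : {additive M -> sg_quot S})
    (sm_quot_scale_subproof a).

Lemma sm_quot_scaleE a x : sm_quot_scale a (sg_pi S x) = sg_pi S (a *: x).
Proof. exact: sg_liftE. Qed.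

Fact sm_quot_scalerA a b (x : sm_quot) :
  sm_quot_scale a (sm_quot_scale b x) = sm_quot_scale (a * b) x.
Proof.
by have [{}x <-] := sg_pi_surj x; rewrite !sm_quot_scaleE scalerA.
Qed.
Fact sm_quot_scale1r : left_id 1 (sm_quot_scale : R -> sm_quot -> sm_quot).
Proof.
by move=> x; have [{}x <-] := sg_pi_surj x; rewrite sm_quot_scaleE scale1r.
Qed.
Fact sm_quot_scalerDr :
  right_distributive (sm_quot_scale : R -> sm_quot -> sm_quot) +%R.
Proof. by move=> a x y; apply: raddfD. Qed.
Fact sm_quot_scalerDl (x : sm_quot) :
  {morph (fun a => sm_quot_scale a x : sm_quot) : a b / a + b}.
Proof.
move=> a b; have [{}x <-] := sg_pi_surj x.
by rewrite !sm_quot_scaleE scalerDl raddfD.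
Qed.
HB.instance Definition _ := GRing.Zmodule_isLmodule.Build R sm_quot
  sm_quot_scalerA sm_quot_scale1r sm_quot_scalerDr sm_quot_scalerDl.

Fact sm_pi_is_linear : linear (fun x => sg_pi S x : sm_quot).
Proof. by move=> a x y; rewrite raddfD -sm_quot_scaleE. Qed.
Definition sm_pi : {linear M -> sm_quot} := mk_linear sm_pi_is_linear.

Lemma sm_pi_eq0 x : sm_pi x = 0 <-> S x. Proof. exact: sg_pi_eq0. Qed.
Lemma sm_pi_surj q : exists x, sm_pi x = q. Proof. exact: sg_pi_surj. Qed.

End Submodule.

Section Constructions.
Variables (R : pzRingType).
Implicit Types M N P : lmodType R.

Definition scaled M (E : M -> Prop) (y : M) := exists b z, E z /\ y = b *: z.

(** The elements whose multiple by [a] lies in the generated subgroup form a subgroup, and it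
    contains all multiples of the generators. *)
Fact gen_submodule_subproof M (E : M -> Prop) (a : R) x :
  gen_subgroup (scaled E) x -> gen_subgroup (scaled E) (a *: x).
Proof.
move=> Ex; have T0 : gen_subgroup (scaled E) (a *: (0 : M)).
  by rewrite scaler0; apply: sg_mem0.
have TB y z : gen_subgroup (scaled E) (a *: y) ->
    gen_subgroup (scaled E) (a *: z) -> gen_subgroup (scaled E) (a *: (y - z)).
  by move=> Ty Tz; rewrite scalerBr; apply: sg_memB.
apply: (Ex (Subgroup T0 TB)) => _ [b [z [Ez ->]]] U; apply.
by exists (a * b), z; rewrite scalerA.
Qed.

Definition gen_submodule M (E : M -> Prop) : submodule M :=
  Submodule (@gen_submodule_subproof M E).

Lemma gen_submodule_gen M (E : M -> Prop) x : E x -> gen_submodule E x.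
Proof. by move=> Ex U; apply; exists 1, x; rewrite scale1r. Qed.

Lemma gen_submodule_ind M (E S : M -> Prop) :
  S 0 -> (forall x y, S x -> S y -> S (x - y)) ->
  (forall a x, E x -> S (a *: x)) -> forall x, gen_submodule E x -> S x.
Proof.
move=> S0 SB SE x /(_ (Subgroup S0 SB)); apply=> _ [b [z [Ez ->]]].
exact: SE.
Qed.

Definition im_submodule M N (f : {linear M -> N}) : submodule N.
Proof.
unshelve refine (@Submodule R N (@Subgroup N (fun y => exists x, f x = y) _ _) _).
- by exists 0; rewrite linear0.
- by move=> _ _ [x <-] [y <-]; exists (x - y); rewrite linearB.
- by move=> a _ [x <-]; exists (a *: x); rewrite linearZZ.
Defined.

Definition ker_submodule M N (f : {linear M -> N}) : submodule M.
Proof.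
unshelve refine (@Submodule R M (@Subgroup M (fun x => f x = 0) _ _) _).
- by rewrite linear0.
- by move=> x y fx fy; rewrite /= linearB fx fy subrr.
- by move=> a x fx; rewrite /= linearZZ fx scaler0.
Defined.

(** Since [f] kills the kernel of [k], it descends to the image of [k], from where injectivity of
    [E] extends it. *)
Lemma injective_extend (E M N : lmodType R) (k : {linear M -> N})
    (f : {linear M -> E}) : injective_module E ->
  (forall x, k x = 0 -> f x = 0) -> exists g : {linear N -> E}, forall x, g (k x) = f x.
Proof.
move=> injE kf.
have [|||h hP] := @choice_linear R (sm_type (im_submodule k)) E
    (fun y z => exists x, k x = sm_val (im_submodule k) y /\ f x = z).
- by move=> y; have [x kx] := sm_valP y; exists (f x), x.
- move=> a y y' _ _ [x [kx <-]] [x' [kx' <-]]; exists (a *: x + x').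
  by rewrite !linearP kx kx'.
- by move=> _ [x [kx <-]]; apply: kf; rewrite kx linear0.
have [g gP] := injE _ _ (sm_val (im_submodule k)) h (@sm_val_inj _ _ _).
exists g => x; have kx : im_submodule k (k x) by exists x.
by rewrite -(sm_valK kx) gP; symmetry; apply/hP; exists x.
Qed.

Lemma linear_lift M N P (p : {linear M -> N}) (f : {linear M -> P}) :
  (forall y, exists x, p x = y) -> (forall x, p x = 0 -> f x = 0) ->
  exists g : {linear N -> P}, forall x, g (p x) = f x.
Proof.
move=> psurj pf.
have [|||g gP] := @choice_linear R N P (fun y z => exists x, p x = y /\ f x = z).
- by move=> y; have [x px] := psurj y; exists (f x), x.
- move=> a y y' _ _ [x [<- <-]] [x' [<- <-]]; exists (a *: x + x').
  by rewrite !linearP.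
- by move=> _ [x [px <-]]; apply: pf.
by exists g => x; symmetry; apply/gP; exists x.
Qed.

Lemma epi_surj M N (f : hom (M : Mod R) N) :
  is_epi f <-> forall y, exists x, (f : {linear M -> N}) x = y.
Proof.
split=> [epif y|surjf P u v uv].
  pose f' : {linear M -> N} := f.
  have : (sm_pi (im_submodule f') : hom (N : Mod R) _) = hom0 _ _.
    apply: epif; apply: linear_eq => x; apply/sm_pi_eq0; by exists x.
  move=> /(congr1 (fun h : {linear _ -> _} => h y)); exact: (sm_pi_eq0 _ _).1.
apply: linear_eq => y; have [x <-] := surjf y.
exact: (congr1 (fun h : {linear _ -> _} => h x) uv).
Qed.

End Constructions.

(** * Tensor products *)

Definition mk_additive (A B : zmodType) (f : A -> B) (f_add : zmod_morphism f) :
  {additive A -> B} := HB.pack f (GRing.isZmodMorphism.Build A B f f_add).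

Section TensorTheory.
Variable R : pzRingType.
Implicit Types (X Y W : lmodType (opring R)) (M N P : lmodType R).

(** The projection modulo [S] agrees with 0 on pure tensors, hence everywhere. *)
Lemma tensor_ind X N (S : subgroup (tensor X N)) :
  (forall x n, S (tens x n)) -> forall t, S t.
Proof.
move=> St t; apply/sg_pi_eq0.
suff -> : sg_pi S = \0%R :> {additive tensor X N -> sg_quot S} by [].
by apply: tensor_ext => x n; apply/sg_pi_eq0.
Qed.

Fact tensl_is_additive X N (n : N) : zmod_morphism (fun x : X => tens x n).
Proof.
by move=> x y; apply: (addIr (tens y n)); rewrite subrK -tensDl subrK.
Qed.
Definition tensl X N (n : N) := mk_additive (@tensl_is_additive X N n).

Fact tensr_is_additive X N (x : X) : zmod_morphism (fun n : N => tens x n).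
Proof.
by move=> y z; apply: (addIr (tens x z)); rewrite subrK -tensDr subrK.
Qed.
Definition tensr X N (x : X) := mk_additive (@tensr_is_additive X N x).

Lemma tens0l X N (n : N) : tens (0 : X) n = 0.
Proof. exact: (raddf0 (tensl X n)). Qed.
Lemma tens0r X N (x : X) : tens x (0 : N) = 0.
Proof. exact: (raddf0 (tensr N x)). Qed.
Lemma tensNr X N (x : X) (n : N) : tens x (- n) = - tens x n.
Proof. exact: (raddfN (tensr N x)). Qed.
Lemma tensBr X N (x : X) (m n : N) : tens x (m - n) = tens x m - tens x n.
Proof. exact: (raddfB (tensr N x)). Qed.
Lemma tensBl X N (x y : X) (n : N) : tens (x - y) n = tens x n - tens y n.
Proof. exact: (raddfB (tensl X n)). Qed.
Lemma tens_suml X N I (r : seq I) (P : pred I) (x : I -> X) (n : N) :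
  tens (\sum_(i <- r | P i) x i) n = \sum_(i <- r | P i) tens (x i) n.
Proof. exact: (raddf_sum (tensl X n)). Qed.
Lemma tens_sumr X N I (r : seq I) (P : pred I) (x : X) (n : I -> N) :
  tens x (\sum_(i <- r | P i) n i) = \sum_(i <- r | P i) tens x (n i).
Proof. exact: (raddf_sum (tensr N x)). Qed.

Definition tmapl X Y N (h : {linear X -> Y}) : {additive tensor X N -> tensor Y N} :=
  tensor_map h idfun.
Definition tmapr X M N (f : {linear M -> N}) : {additive tensor X M -> tensor X N} :=
  tensor_map idfun f.

Lemma tmaplE X Y N (h : {linear X -> Y}) x (n : N) :
  tmapl N h (tens x n) = tens (h x) n.
Proof. exact: tensor_mapE. Qed.
Lemma tmaprE X M N (f : {linear M -> N}) (x : X) m :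
  tmapr X f (tens x m) = tens x (f m).
Proof. exact: tensor_mapE. Qed.

Lemma tmaplr X Y M N (h : {linear X -> Y}) (f : {linear M -> N}) t :
  tmapl N h (tmapr X f t) = tmapr Y f (tmapl M h t).
Proof.
apply: (congr1 (fun k : {additive _ -> _} => k t)
  (x := (tmapl N h \o tmapr X f : {additive _ -> _}))
  (y := (tmapr Y f \o tmapl M h : {additive _ -> _}))).
by apply: tensor_ext => x m; rewrite /= !(tmaplE, tmaprE).
Qed.

Lemma tmapr_ext X M N (f g : {linear M -> N}) t : f =1 g -> tmapr X f t = tmapr X g t.
Proof. by move/linear_eq => ->. Qed.

Lemma tmapl_ext X Y N (f g : {linear X -> Y}) t : f =1 g -> tmapl N f t = tmapl N g t.
Proof. by move/linear_eq => ->. Qed.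

Lemma tmapr_comp X M N P (g : {linear N -> P}) (f : {linear M -> N}) t :
  tmapr X g (tmapr X f t) = tmapr X (g \o f : {linear _ -> _}) t.
Proof.
apply: (congr1 (fun k : {additive _ -> _} => k t)
  (x := (tmapr X g \o tmapr X f : {additive _ -> _}))).
by apply: tensor_ext => x m; rewrite /= !tmaprE.
Qed.

Lemma tmapl_comp X Y W N (g : {linear Y -> W}) (f : {linear X -> Y}) t :
  tmapl N g (tmapl N f t) = tmapl N (g \o f : {linear _ -> _}) t.
Proof.
apply: (congr1 (fun k : {additive _ -> _} => k t)
  (x := (tmapl N g \o tmapl N f : {additive _ -> _}))).
by apply: tensor_ext => x m; rewrite /= !tmaplE.
Qed.

Lemma tmapr_id X M t : tmapr X (idfun : {linear M -> M}) t = t.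
Proof.
apply: (congr1 (fun k : {additive _ -> _} => k t)
  (y := (idfun : {additive tensor X M -> tensor X M}))).
by apply: tensor_ext => x m; apply: tmaprE.
Qed.

Lemma tmapl_id X M t : tmapl M (idfun : {linear X -> X}) t = t.
Proof. exact: tmapr_id. Qed.

Lemma tmapr0 X M N t : tmapr X (\0 : {linear M -> N}) t = 0.
Proof.
apply: (congr1 (fun k : {additive _ -> _} => k t)
  (y := (\0 : {additive tensor X M -> tensor X N}))).
by apply: tensor_ext => x m; rewrite /= tmaprE tens0r.
Qed.

Lemma tmaprD X M N (f g : {linear M -> N}) t :
  tmapr X (f \+ g : {linear _ -> _}) t = tmapr X f t + tmapr X g t.
Proof.
apply: (congr1 (fun k : {additive _ -> _} => k t)
  (y := (tmapr X f \+ tmapr X g : {additive _ -> _}))).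
by apply: tensor_ext => x m; rewrite /= !tmaprE tensDr.
Qed.

Lemma tmaprB X M N (f g : {linear M -> N}) t :
  tmapr X (f \- g : {linear _ -> _}) t = tmapr X f t - tmapr X g t.
Proof.
apply: (congr1 (fun k : {additive _ -> _} => k t)
  (y := (tmapr X f \- tmapr X g : {additive _ -> _}))).
by apply: tensor_ext => x m; rewrite /= !tmaprE tensBr.
Qed.

Lemma tmaprN X M N (f : {linear M -> N}) t :
  tmapr X (\- f : {linear _ -> _}) t = - tmapr X f t.
Proof.
apply: (congr1 (fun k : {additive _ -> _} => k t)
  (y := (\- tmapr X f : {additive _ -> _}))).
by apply: tensor_ext => x m; rewrite /= !tmaprE tensNr.
Qed.

(** Right exactness. Modulo the subgroup [D] generated by these tensors, [tens x m] depends only on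
    [f m], so a set-theoretic section of [f] gives a balanced map on X and N; composed with
    [tmapr X f], the induced map is the projection modulo [D]. *)
Lemma tmapr_ker_surj X M N (f : {linear M -> N}) t :
  (forall n, exists m, f m = n) -> tmapr X f t = 0 ->
  gen_subgroup (fun u => exists x m, f m = 0 /\ u = tens x m) t.
Proof.
move=> /choice[s sP] ft0; set D := gen_subgroup _.
have DP x m m' : f m = f m' -> sg_pi D (tens x m) = sg_pi D (tens x m').
  move=> fm; apply/eqP; rewrite -subr_eq0 -raddfB; apply/eqP/sg_pi_eq0.
  move=> S; apply; exists x, (m - m'); rewrite tensBr; split=> //.
  by rewrite linearB fm subrr.
have bal : balanced (fun (x : X) (n : N) => sg_pi D (tens x (s n))).
  split=> [x y n|x n n'|x r n]; first by rewrite tensDl raddfD.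
    by rewrite -raddfD -tensDr; apply: DP; rewrite linearD !sP.
  by rewrite tensM; apply: DP; rewrite linearZZ !sP.
apply/sg_pi_eq0; rewrite -[RHS](raddf0 (tensor_lift bal)) -ft0.
apply: (congr1 (fun k : {additive _ -> _} => k t) (x := sg_pi D)
  (y := (tensor_lift bal \o tmapr X f : {additive _ -> _}))).
apply: tensor_ext => x m; rewrite /= tmaprE tensor_liftE.
by apply: DP; rewrite sP.
Qed.

(* [X] is a right module, with relations [sum_i x_i A_ji = 0]: scalars act    *)
(* through [opring R], but the second clause uses the product of [R].         *)
Definition presentation X (n m : nat) (x : nat -> X) (A : nat -> nat -> R) :=
  (forall w, exists v : nat -> R, w = \sum_(i < n) (v i : opring R) *: x i) /\
  (forall v : nat -> R, \sum_(i < n) (v i : opring R) *: x i = 0 <->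
     exists u : nat -> R, forall i, (i < n)%N -> v i = \sum_(j < m) A j i * u j).

Lemma presentation_rel X n m x A j : @presentation X n m x A -> (j < m)%N ->
  \sum_(i < n) (A j i : opring R) *: x i = 0.
Proof.
case=> _ xA jm; apply/xA; exists (fun k => (k == j)%:R) => i _.
rewrite (bigD1 (Ordinal jm)) //= eqxx mulr1 big1 ?addr0 // => k /eqP kj.
by case: eqP => [/(@ord_inj _ k (Ordinal jm))|_] //; rewrite mulr0.
Qed.

Lemma presentation_hom X Y n m x A (y : nat -> Y) : @presentation X n m x A ->
  (forall j, (j < m)%N -> \sum_(i < n) (A j i : opring R) *: y i = 0) ->
  exists h : {linear X -> Y}, forall i, (i < n)%N -> h (x i) = y i.
Proof.
move=> [xgen xA] yA.
have [|||h hP] := @choice_linear _ X Y (fun w z => exists v : nat -> R,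
    w = \sum_(i < n) (v i : opring R) *: x i /\
    z = \sum_(i < n) (v i : opring R) *: y i).
- by move=> w; have [v ->] := xgen w; exists (\sum_(i < n) (v i : opring R) *: y i), v.
- move=> a _ _ _ _ [v [-> ->]] [v' [-> ->]].
  (* A scalar of [opring R] multiplies coefficients in [R] on the right. *)
  exists (fun i => v i * a + v' i); rewrite !scaler_sumr -!big_split /=.
  by split; apply: eq_bigr => i _; rewrite scalerDl scalerA.
- move=> _ [v [/esym/xA[u vu] ->]].
  rewrite (eq_bigr (fun i : 'I_n =>
    \sum_(j < m) (u j : opring R) *: ((A j i : opring R) *: y i))).
    by rewrite exchange_big big1 // => j _; rewrite -scaler_sumr yA ?scaler0.
  by move=> i _; rewrite vu // scaler_suml; apply: eq_bigr => j _; rewrite scalerA.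
exists h => i ni; apply/esym/hP; exists (fun k => (k == i)%:R).
by split; rewrite (bigD1 (Ordinal ni)) //= eqxx scale1r big1 ?addr0 // => k /eqP ki;
  case: eqP => [/(@ord_inj _ k (Ordinal ni))|_] //; rewrite scale0r.
Qed.

Lemma presentation_hom_eq X Y n m x A (h h' : {linear X -> Y}) :
  @presentation X n m x A -> (forall i, (i < n)%N -> h (x i) = h' (x i)) -> h = h'.
Proof.
move=> [xgen _] hh'; apply: linear_eq => w; have [v ->] := xgen w.
by rewrite !linear_sum; apply: eq_bigr => i _; rewrite !linearZZ hh'.
Qed.

Lemma presentation_tens X N n m x A (t : tensor X N) : @presentation X n m x A ->
  exists b : nat -> N, t = \sum_(i < n) tens (x i) (b i).
Proof.
move=> [xgen _].
pose S t := exists b : nat -> N, t = \sum_(i < n) tens (x i) (b i).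
have S0 : S 0 by exists (fun=> 0); rewrite big1 // => i _; rewrite tens0r.
have SB u v : S u -> S v -> S (u - v).
  move=> [b ->] [c ->]; exists (fun i => b i - c i); rewrite -sumrB.
  by apply: eq_bigr => i _; rewrite tensBr.
apply: (tensor_ind (S := Subgroup S0 SB)) => w b /=.
have [v ->] := xgen w; exists (fun i => v i *: b); rewrite tens_suml.
by apply: eq_bigr => i _; rewrite tensM.
Qed.

(* The map sending [tens w b], with [w = sum_i x_i v_i], to [(v_i b)_i] is    *)
(* well defined modulo the relations.                                         *)
Lemma presentation_tens_eq0 X N n m x A (b : nat -> N) : @presentation X n m x A ->
  \sum_(i < n) tens (x i) (b i) = 0 <->
  exists c : nat -> N, forall i, (i < n)%N -> b i = \sum_(j < m) A j i *: c j.
Proof.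
move=> pr; split; last first.
  move=> [c bc]; under eq_bigr => i _.
    rewrite bc // tens_sumr; under eq_bigr do rewrite -tensM; over.
  rewrite exchange_big big1 // => j _; rewrite -tens_suml.
  by rewrite (presentation_rel pr) ?tens0l.
move: pr => [/choice[v xv] xA].
pose S (b : nat -> N) := exists c : nat -> N,
  forall i, (i < n)%N -> b i = \sum_(j < m) A j i *: c j.
have S0 : S 0 by exists (fun=> 0) => i _; rewrite big1 // => j _; rewrite scaler0.
have SB b1 b2 : S b1 -> S b2 -> S (b1 - b2).
  move=> [c1 E1] [c2 E2]; exists (fun i => c1 i - c2 i) => i ni.
  rewrite fctE [LHS](_ : _ = b1 i - b2 i) // E1 // E2 // -sumrB.
  by apply: eq_bigr => j _; rewrite scalerBr.
pose T := Subgroup S0 SB.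
have vP (u : nat -> R) (d : N) :
    \sum_(i < n) (u i : opring R) *: x i = 0 -> T (fun i => u i *: d).
  move/xA => [w uw]; exists (fun j => w j *: d) => i ni; rewrite uw // scaler_suml.
  by apply: eq_bigr => j _; rewrite scalerA.
have vE (w : X) (u : nat -> R) (d : N) : w = \sum_(i < n) (u i : opring R) *: x i ->
    sg_pi T (fun i => v w i *: d) = sg_pi T (fun i => u i *: d).
  move=> wE; apply/eqP; rewrite -subr_eq0 -raddfB; apply/eqP/sg_pi_eq0.
  have wu0 : \sum_(i < n) (v w i - u i : opring R) *: x i = 0.
    by under eq_bigr do rewrite scalerBl; rewrite sumrB -xv -wE subrr.
  have := vP (fun i => v w i - u i) d wu0; congr (sg_mem T _); apply/funext => i.
  exact: scalerBl.
have bal : balanced (fun (w : X) (d : N) => sg_pi T (fun i => v w i *: d)).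
  split=> [w w' d|w d d'|w r d].
  - rewrite -raddfD (vE _ (fun i => v w i + v w' i)).
      by congr (sg_pi T _); apply/funext => i; rewrite scalerDl.
    by under eq_bigr do rewrite scalerDl; rewrite big_split /= -!xv.
  - by rewrite -raddfD; congr (sg_pi T _); apply/funext => i; rewrite scalerDr.
  - rewrite (vE _ (fun i => v w i * r)).
      by congr (sg_pi T _); apply/funext => i; rewrite scalerA.
    by rewrite {1}(xv w) scaler_sumr; apply: eq_bigr => i _; rewrite scalerA.
(* On [tens (x i) (b i)] the map can be computed with the i-th unit vector as coordinates of [x i];
   the whole sum therefore goes to the class of [b]. *)
move=> /(congr1 (tensor_lift bal)); rewrite raddf_sum raddf0 /=.
under eq_bigr => i _.
  rewrite tensor_liftE (vE _ (fun k => (k == i)%:R)); last first.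
    rewrite (bigD1 i) //= eqxx scale1r big1 ?addr0 // => k ki.
    by rewrite -[k == i :> nat]/(k == i) (negPf ki) scale0r.
  over.
rewrite -raddf_sum => /sg_pi_eq0[c cP]; exists c => i ni; rewrite -cP //.
rewrite fct_sumE (bigD1 (Ordinal ni)) //= eqxx scale1r big1 ?addr0 // => k ki.
by rewrite -[i == k :> nat]/(Ordinal ni == k) eq_sym (negPf ki) scale0r.
Qed.

End TensorTheory.

(** * Presentations and purity *)

Section Presentations.
Variable R : pzRingType.

Definition nat_row (S : pzRingType) n (v : nat -> S) : 'rV[S]_n := \row_i v i.

Lemma nat_row_sum (S : pzRingType) n (v : nat -> S) :
  nat_row n v = \sum_(i < n) v i *: nat_row n (fun k => (k == i)%:R).
Proof.
rewrite [LHS]row_sum_delta; apply: eq_bigr => i _; rewrite mxE; congr (_ *: _).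
by apply/rowP => k; rewrite !mxE eqxx.
Qed.

Lemma nat_rowP (S : pzRingType) n (v : 'rV[S]_n) : exists u, v = nat_row n u.
Proof.
exists (fun i => if insub i is Some k then v 0 k else 0); apply/rowP => k.
by rewrite mxE valK.
Qed.

Lemma presentation_coker (n m : nat) (A : nat -> nat -> R) :
  exists (X : lmodType (opring R)) (x : nat -> X),
    finitely_presented X /\ presentation n m x A.
Proof.
pose S := opring R.
have g_lin : linear (fun u : 'rV[S]_m =>
    nat_row n (fun i => \sum_(j < m) u 0 j * (A j i : S))).
  move=> a u v; apply/rowP => i; rewrite !mxE mulr_sumr -big_split /=.
  by apply: eq_bigr => j _; rewrite !mxE mulrDl mulrA.
pose g := mk_linear g_lin; pose p := sm_pi (im_submodule g).
exists (sm_quot (im_submodule g)), (fun i => p (nat_row n (fun k => (k == i)%:R))).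
have p_sum (v : nat -> S) :
    \sum_(i < n) v i *: p (nat_row n (fun k => (k == i)%:R)) = p (nat_row n v).
  by rewrite (nat_row_sum n v) linear_sum; apply: eq_bigr => i _; rewrite linearZZ.
split; [exists m, n, g, p; split|split].
- exact: sm_pi_surj.
- exact: sm_pi_eq0.
- move=> w; have [v0 <-] := sm_pi_surj w; have [v ->] := nat_rowP v0.
  by exists v; rewrite p_sum.
move=> v; rewrite p_sum; split=> [/sm_pi_eq0[u /rowP gu]|[u vu]].
  have [u' uu'] := nat_rowP u; exists u' => i ni.
  have := gu (Ordinal ni); rewrite !mxE /= => <-.
  by apply: eq_bigr => j _; rewrite uu' mxE.
apply/sm_pi_eq0; exists (nat_row m u); apply/rowP => i; rewrite !mxE vu //.
by apply: eq_bigr => j _; rewrite mxE.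
Qed.

Lemma presentation_fp (X : lmodType (opring R)) : finitely_presented X ->
  exists n m x A, @presentation R X n m x A.
Proof.
move=> [m [n [g [p [psurj pg]]]]]; pose S := opring R.
pose e k (i : nat) : 'rV[S]_k := nat_row k (fun j => (j == i)%:R).
exists n, m, (fun i => p (e n i)),
  (fun j i => if insub i is Some k then g (e m j) 0 k else 0).
have p_sum (v : nat -> S) : \sum_(i < n) v i *: p (e n i) = p (nat_row n v).
  by rewrite (nat_row_sum n v) linear_sum; apply: eq_bigr => i _; rewrite linearZZ.
split=> [w|v].
  have [v0 <-] := psurj w; have [v ->] := nat_rowP v0.
  by exists v; rewrite p_sum.
rewrite p_sum; split=> [/pg[u gu]|[u vu]].
  have [u' uu'] := nat_rowP u; exists u' => i ni.
  move/rowP/(_ (Ordinal ni)): gu; rewrite uu' nat_row_sum linear_sum summxE mxE => <-.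
  by apply: eq_bigr => j _; rewrite linearZZ mxE insubT.
apply/pg; exists (@nat_row S m u); apply/rowP => i.
rewrite (@nat_row_sum S m u) linear_sum summxE mxE vu //.
by apply: eq_bigr => j _; rewrite linearZZ mxE valK.
Qed.

End Presentations.

Lemma big_uniq_extend (K : eqType) (A : nmodType) (l l' : seq K) (f : K -> A) :
  uniq l -> uniq l' -> {subset l <= l'} -> (forall k, k \notin l -> f k = 0) ->
  \sum_(k <- l') f k = \sum_(k <- l) f k.
Proof.
move=> ul ul' ll' f0; rewrite (bigID (mem l)) /= [X in _ + X]big1 // addr0.
rewrite -big_filter; apply: perm_big; apply: uniq_perm; rewrite ?filter_uniq //.
by move=> k; rewrite mem_filter andb_idr //; apply: ll'.
Qed.

Lemma big_uniq_delta (K : eqType) (A : nmodType) (l : seq K) (k : K) (f : K -> A) :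
  uniq l -> k \in l -> \sum_(i <- l) (if i == k then f i else 0) = f k.
Proof.
move=> ul kl; rewrite (big_rem k kl) /= eqxx -big_mkcond big1_seq ?addr0 // => i.
by rewrite rem_filter // mem_filter /= => /andP[/eqP-> /andP[/eqP]].
Qed.

Section Purity.
Variable R : pzRingType.
Implicit Types (X : lmodType (opring R)) (M N : lmodType R).

(** Purity in terms of linear systems: a finite system with constants in [M] that is solvable in [N]
    is solvable in [M]. *)
Definition fin_pure M N (f : {linear M -> N}) :=
  forall (n m : nat) (A : nat -> nat -> R) (b : nat -> M) (c : nat -> N),
    (forall i, (i < n)%N -> f (b i) = \sum_(j < m) A j i *: c j) ->
    exists c' : nat -> M, forall i, (i < n)%N -> b i = \sum_(j < m) A j i *: c' j.

(** The matrix of the system presents a right module X; by [presentation_tens_eq0] the system is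
    solvable exactly when the tensor of generators of X with the constants vanishes. *)
Lemma fp_mono_fin_pure M N (f : {linear M -> N}) :
  (forall X (t : tensor X M), finitely_presented X -> tmapr X f t = 0 -> t = 0) ->
  fin_pure f.
Proof.
move=> fmono n m A b c bc; have [X [x [fpX pr]]] := presentation_coker n m A.
apply/(presentation_tens_eq0 b pr)/(fmono _ _ fpX).
rewrite raddf_sum /=; under eq_bigr do rewrite tmaprE.
by apply/(presentation_tens_eq0 (fun i => f (b i)) pr); exists c.
Qed.

Lemma tensor_seq X N (t : tensor X N) :
  exists s : seq (X * N), t = \sum_(q <- s) tens q.1 q.2.
Proof.
pose S t := exists s : seq (X * N), t = \sum_(q <- s) tens q.1 q.2.
have S0 : S 0 by exists [::]; rewrite big_nil.
have SB u v : S u -> S v -> S (u - v).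
  move=> [s ->] [s' ->]; exists (s ++ [seq (q.1, - q.2) | q <- s']).
  rewrite big_cat big_map /= -sumrN; congr (_ + _).
  by apply: eq_bigr => q _; rewrite tensNr.
apply: (tensor_ind (S := Subgroup S0 SB)) => x n.
by exists [:: (x, n)]; rewrite big_seq1.
Qed.

(* If [X] is generated by all its elements, with relations the finite linear   *)
(* dependencies, then [X] tensor [N] embeds in the functions [X -> N] modulo   *)
(* the combinations of dependencies with coefficients in [N].                  *)
Section VanishingCriterion.
Variables (X : lmodType (opring R)) (N : lmodType R).

Definition combination (w : X -> N) (L : seq X) (p : nat) (A : nat -> X -> R)
    (c : nat -> N) :=
  [/\ forall j, (j < p)%N -> \sum_(x <- L) (A j x : opring R) *: x = 0,
      forall j x, x \notin L -> A j x = 0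
    & forall x, w x = \sum_(j < p) A j x *: c j].

Definition combinations (w : X -> N) :=
  exists L p A c, uniq L /\ combination w L p A c.

Fact combinations0 : combinations 0.
Proof.
exists [::], 0, (fun _ _ => 0), (fun=> 0); split=> //; split=> // x.
by rewrite big_ord0.
Qed.

Fact combinationsB w w' : combinations w -> combinations w' -> combinations (w - w').
Proof.
move=> [L [p [A [c [uL [A0 AL wA]]]]]] [L' [p' [A' [c' [uL' [A'0 AL' wA']]]]]].
exists (undup (L ++ L')), (p + p')%N,
  (fun j x => if (j < p)%N then A j x else A' (j - p)%N x),
  (fun j => if (j < p)%N then c j else - c' (j - p)%N).
split; first exact: undup_uniq.
split=> [j jp|j x|x].
- case: ltnP => pj.
    rewrite -[RHS](A0 _ pj); apply: big_uniq_extend; rewrite ?undup_uniq //.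
      by move=> x xL; rewrite mem_undup mem_cat xL.
    by move=> x /(AL j) ->; rewrite scale0r.
  have pj' : (j - p < p')%N by rewrite ltn_subLR.
  rewrite -[RHS](A'0 _ pj'); apply: big_uniq_extend; rewrite ?undup_uniq //.
    by move=> x xL; rewrite mem_undup mem_cat xL orbT.
  by move=> x /(AL' (j - p)%N) ->; rewrite scale0r.
- by rewrite mem_undup mem_cat negb_or => /andP[xL xL']; case: ifP => _; auto.
rewrite big_split_ord /= -[LHS]/(w x - w' x) wA wA' -sumrN.
congr (_ + _); apply: eq_bigr => j _; first by rewrite ltn_ord.
by rewrite ltnNge leq_addr /= addKn scalerN.
Qed.

Definition combination_subgroup : subgroup (X -> N) :=
  Subgroup combinations0 combinationsB.

Definition single (x : X) (b : N) : X -> N := fun y => if y == x then b else 0.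

(** Elements may repeat in [K]; grouping the coefficients by element turns [K] into one dependency,
    with coefficient [b]. *)
Lemma combination_single (K : seq (X * R)) (b : N) :
  \sum_(k <- K) (k.2 : opring R) *: k.1 = 0 ->
  combination_subgroup (fun y => \sum_(k <- K) single k.1 (k.2 *: b) y).
Proof.
move=> K0; pose L := undup (map fst K).
exists L, 1%N, (fun _ y => \sum_(k <- K) if y == k.1 then k.2 else 0), (fun=> b).
split; first exact: undup_uniq.
split=> [j _|j y yL|y].
- rewrite -[RHS]K0.
  under eq_bigr do rewrite scaler_suml; rewrite exchange_big /= big_seq [RHS]big_seq.
  apply: eq_bigr => k kK.
  rewrite -[RHS](big_uniq_delta (fun y => (k.2 : opring R) *: y)
    (undup_uniq (map fst K))).
    by apply: eq_bigr => y _; case: ifP => // _; rewrite scale0r.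
  by rewrite mem_undup map_f.
- rewrite big_seq big1 // => k kK; case: eqP => // yk.
  by case/negP: yL; rewrite yk mem_undup map_f.
rewrite big_ord1 scaler_suml; apply: eq_bigr => k _.
by rewrite /single; case: ifP => // _; rewrite scale0r.
Qed.

Lemma tens_seq_eq0 (s : seq (X * N)) : \sum_(q <- s) tens q.1 q.2 = 0 ->
  exists (L : seq X) p A c, [/\ uniq L, {subset map fst s <= L} &
    combination (fun x => \sum_(q <- s | q.1 == x) q.2) L p A c].
Proof.
pose V := combination_subgroup.
have piE w w' : V (w - w') -> sg_pi V w = sg_pi V w'.
  by move=> Vw; apply/eqP; rewrite -subr_eq0 -raddfB; apply/eqP/sg_pi_eq0.
have bal : balanced (fun x b => sg_pi V (single x b)).
  (* Additivity in X and balancedness hold modulo the dependencies (x + x') - x - x' = 0 and (r x) -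
     r x = 0; additivity in N holds exactly. *)
  split=> [x x' b|x b b'|x r b].
  - rewrite -raddfD; apply: piE.
    have := @combination_single [:: (x + x', 1); (x, -1); (x', -1)] b.
    rewrite !big_cons !big_nil /= !scaleN1r !scale1r addr0 -opprD subrr.
    move=> /(_ erefl); congr (sg_mem V _); apply/funext => y.
    rewrite !big_cons big_nil /= addr0 scale1r scaleN1r fctE !fctE /single /=.
    by case: (y == x); case: (y == x'); rewrite ?(oppr0, addr0, opprD).
  - rewrite -raddfD; congr (sg_pi V _); apply/funext => y.
    by rewrite /single !fctE; case: ifP; rewrite ?addr0.
  - apply: piE.
    have := @combination_single [:: ((r : opring R) *: x, 1); (x, - r)] b.
    rewrite !big_cons !big_nil /= scale1r scaleNr addr0 subrr => /(_ erefl).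
    congr (sg_mem V _); apply/funext => y.
    rewrite !big_cons big_nil /= addr0 scale1r scaleNr fctE /single.
    rewrite -[X in _ = _ + X]/(- (if y == x then r *: b else 0)).
    by case: (y == x); rewrite ?oppr0.
move=> /(congr1 (tensor_lift bal)); rewrite raddf_sum raddf0 /=.
under eq_bigr do rewrite tensor_liftE.
rewrite -raddf_sum => /sg_pi_eq0[L [p [A [c [uL [A0 AL wA]]]]]].
(* The support is enlarged to cover the first components of [s], as [tens_group] requires. *)
exists (undup (L ++ map fst s)), p, A, c; split; first exact: undup_uniq.
  by move=> x xs; rewrite mem_undup mem_cat xs orbT.
split=> [j jp|j x|x].
- rewrite -[RHS](A0 _ jp); apply: big_uniq_extend; rewrite ?undup_uniq //.
    by move=> x xL; rewrite mem_undup mem_cat xL.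
  by move=> x /(AL j) ->; rewrite scale0r.
- by rewrite mem_undup mem_cat negb_or => /andP[xL _]; apply: AL.
rewrite -wA fct_sumE big_mkcond; apply: eq_bigr => q _.
by rewrite /single eq_sym.
Qed.

End VanishingCriterion.

Lemma tens_group (X : lmodType (opring R)) N (s : seq (X * N)) (L : seq X) :
  uniq L -> {subset map fst s <= L} ->
  \sum_(q <- s) tens q.1 q.2 = \sum_(x <- L) tens x (\sum_(q <- s | q.1 == x) q.2).
Proof.
move=> uL sL; under [RHS]eq_bigr do rewrite tens_sumr big_mkcond.
rewrite exchange_big big_seq [RHS]big_seq; apply: eq_bigr => q qs /=.
rewrite -(big_uniq_delta (fun x => tens x q.2) uL (sL _ (map_f _ qs))).
by apply: eq_bigr => x _; rewrite eq_sym.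
Qed.

(** For arbitrary X the vanishing of a tensor over [N] is witnessed by finitely many dependencies
    among finitely many elements of X ([tens_seq_eq0]). This is a finite system with constants in
    the image of [M]; a solution in [M] kills the original tensor by the same dependencies. *)
Lemma fin_pure_pure_mono M N (f : {linear M -> N}) : fin_pure f -> pure_mono f.
Proof.
move=> pf; have f0 m : f m = 0 -> m = 0.
  move=> fm; have [|c' /(_ 0 isT)] := pf 1 0 (fun _ _ => 0) (fun=> m) (fun=> 0).
    by move=> i _; rewrite fm big_ord0.
  by rewrite big_ord0.
split=> [m m' fmm|X t t' ftt].
  by apply/eqP; rewrite -subr_eq0; apply/eqP/f0; rewrite linearB fmm subrr.
apply/eqP; rewrite -subr_eq0; apply/eqP.
have {ftt} : tmapr X f (t - t') = 0 by rewrite raddfB; apply/eqP; rewrite subr_eq0 ftt.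
have [s ->] := tensor_seq (t - t').
rewrite raddf_sum /=; under eq_bigr do rewrite tmaprE.
pose s' := [seq (q.1, f q.2) | q <- s] => s0.
have [|L [p [A [c [uL sL [A0 AL wA]]]]]] := @tens_seq_eq0 _ _ s'.
  by rewrite big_map.
have s'E : map fst s' = map fst s by rewrite -map_comp.
rewrite s'E in sL; rewrite (tens_group uL sL).
have [|c' c'P] := pf (size L) p (fun j i => A j (nth 0 L i))
    (fun i => \sum_(q <- s | q.1 == nth 0 L i) q.2) c.
  by move=> i _; rewrite -wA linear_sum big_map.
have c'E x : x \in L -> \sum_(q <- s | q.1 == x) q.2 = \sum_(j < p) A j x *: c' j.
  by move=> xL; rewrite -{1}(nth_index 0 xL) c'P ?index_mem // nth_index.
rewrite big_seq; under eq_bigr => x xL.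
  rewrite c'E // tens_sumr; under eq_bigr do rewrite -tensM; over.
rewrite -big_seq exchange_big big1 // => j _.
by rewrite -tens_suml A0 ?tens0l.
Qed.

End Purity.

(** * Subfunctors and extensions of tensor functors *)

Lemma sg_mem_sum (A : zmodType) (S : subgroup A) I (r : seq I) (P : pred I)
    (f : I -> A) :
  (forall i, P i -> S (f i)) -> S (\sum_(i <- r | P i) f i).
Proof. by move=> Sf; elim/big_ind: _ => //; [apply: sg_mem0 | apply: sg_memD]. Qed.

Section TensorRegular.
Variables (R : pzRingType) (X : lmodType (opring R)).

Fact tens_reg_balanced :
  balanced (fun (x : X) (r : R^o) => ((r : R) : opring R) *: x).
Proof.
split=> [x y r|x r s|x r s]; first exact: scalerDr.
  exact: scalerDl.
by rewrite scalerA.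
Qed.

Definition tens_reg : {additive tensor X (R^o : lmodType R) -> X} :=
  tensor_lift tens_reg_balanced.

Lemma tens_regE (x : X) (r : R) : tens_reg (tens x (r : R^o)) = (r : opring R) *: x.
Proof. exact: tensor_liftE. Qed.

End TensorRegular.

Lemma pair_eqP (A B : Type) (x y : A * B) : x.1 = y.1 -> x.2 = y.2 -> x = y.
Proof. by case: x y => [x1 x2] [y1 y2] /= -> ->. Qed.

(* Write each element of each [L X] as [sum_i tens (x i) (val i)] for a        *)
(* presentation [rel] of [X], and adjoin to [M] universal elements [d j] with  *)
(* [val i = sum_j rel j i *: d j]. Since only the coordinates of the adjoined  *)
(* elements matter, they may live in a full product instead of a free module.  *)
Section SubfunctorKernel.
Variables (R : pzRingType) (M : lmodType R).
Variable L : forall X : fpmod R, subgroup (tensor (fpmod_sort X) M).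
Hypothesis LF : forall (X Y : fpmod R) (h : {linear fpmod_sort X -> fpmod_sort Y}) t,
  L X t -> L Y (tmapl M h t).

Let T : Type := {classic (nat * nat * (nat -> nat -> R) * (nat -> M))%type}.
Let ngen (k : T) : nat := k.1.1.1.
Let nrel (k : T) : nat := k.1.1.2.
Let rel (k : T) : nat -> nat -> R := k.1.2.
Let val (k : T) : nat -> M := k.2.

Let good (k : T) := exists (X : fpmod R) (x : nat -> fpmod_sort X),
  presentation (ngen k) (nrel k) x (rel k) /\
  L X (\sum_(i < ngen k) tens (x i) (val k i)).

Let N : lmodType R := (M * (T -> nat -> R^o))%type.

Let col (k : T) (i : nat) : N :=
  (val k i, fun k' j => if (k' == k) && (j < nrel k)%N then rel k j i : R^o else 0).

Let S : submodule N :=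
  gen_submodule (fun y => exists k i, [/\ good k, (i < ngen k)%N & y = col k i]).

Fact inl_N_linear : linear (fun m : M => (m, 0) : N).
Proof. by move=> a m m'; apply: pair_eqP; rewrite //= scaler0 addr0. Qed.
Let inl_N : {linear M -> N} := mk_linear inl_N_linear.

Let fst_N : {linear N -> M} := fst.
Let snd_N : {linear N -> (T -> nat -> R^o)} := snd.

Fact coord_linear (k : T) (j : nat) : linear (fun y : N => y.2 k j).
Proof. by []. Qed.
Let coord k j : {linear N -> R^o} := mk_linear (coord_linear k j).

Let g : {linear M -> sm_quot S} := sm_pi S \o inl_N.

(** In the quotient the coefficients of [t] become combinations of the adjoined elements along the
    relations of X, which by [presentation_tens_eq0] makes the tensor vanish. *)
Let g_kills (X : fpmod R) t : L X t -> tmapr (fpmod_sort X) g t = 0.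
Proof.
move=> Lt; have [n [m [x [A pr]]]] := presentation_fp (svalP X).
have [b tE] := presentation_tens t pr; rewrite tE in Lt *.
pose k : T := (n, m, A, b).
have goodk : good k by exists X, x.
rewrite raddf_sum /=; under eq_bigr do rewrite tmaprE.
apply/(presentation_tens_eq0 (fun i => g (b i)) pr).
pose d j : N := (0, fun k' j' => if (k' == k) && (j' == j) then 1 else 0).
exists (fun j => - sm_pi S (d j)) => i ni.
have /sm_pi_eq0 c0 : S (col k i) by apply: gen_submodule_gen; exists k, i.
rewrite -[LHS]/(sm_pi S (b i, 0)).
rewrite (_ : (b i, 0) = col k i - \sum_(j < m) A j i *: d j).
  rewrite linearB c0 sub0r linear_sum -sumrN; apply: eq_bigr => j _.
  by rewrite linearZZ scalerN.
apply: pair_eqP => /=.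
  by rewrite (linear_sum fst_N) big1 ?subr0 // => j _; rewrite linearZZ /= scaler0.
rewrite (linear_sum snd_N) /=; apply/funext => k'; apply/funext => j'.
rewrite -[RHS]/(_ - (\sum_(j < m) (A j i *: (d j).2)) k' j') !fct_sumE.
rewrite (eq_bigr (fun j : 'I_m =>
  A j i * (if (k' == k) && (j' == j) then 1 else 0))) //.
case: eqP => [_|_] /=; last by rewrite big1 ?subr0 // => j _; rewrite mulr0.
have [jm|jm] := ltnP.
  rewrite (bigD1 (Ordinal jm)) //= eqxx mulr1 big1 ?addr0 ?subrr // => j jj.
  by rewrite -[j' == j :> nat]/(Ordinal jm == j) eq_sym (negPf jj) mulr0.
rewrite big1 ?subr0 // => j _.
by rewrite (gtn_eqF (leq_trans (ltn_ord j) jm)) mulr0.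
Qed.

Let rep (X : fpmod R) (z : tensor (fpmod_sort X) N) :=
  exists (l : seq T) (V : T -> nat -> fpmod_sort X),
    [/\ uniq l, forall k, k \in l -> good k, forall k, k \notin l -> forall i, V k i = 0
      & z = \sum_(k <- l) \sum_(i < ngen k) tens (V k i) (col k i)].

(** By right exactness the kernel is generated by tensors with elements of [S], hence by tensors
    with the columns; these are collected over a finite list of indices. *)
Let rep_ker (X : fpmod R) t : tmapr (fpmod_sort X) g t = 0 -> rep (tmapr _ inl_N t).
Proof.
rewrite -tmapr_comp => /(tmapr_ker_surj (@sm_pi_surj _ _ S)).
have rep0 : @rep X 0 by exists [::], 0; split=> //; rewrite big_nil.
have repB z z' : @rep X z -> rep z' -> rep (z - z').
  move=> [l [V [ul lgood V0 ->]]] [l' [V' [ul' l'good V'0 ->]]].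
  have sub : {subset l <= undup (l ++ l')}.
    by move=> k kl; rewrite mem_undup mem_cat kl.
  have sub' : {subset l' <= undup (l ++ l')}.
    by move=> k kl; rewrite mem_undup mem_cat kl orbT.
  exists (undup (l ++ l')), (fun k i => V k i - V' k i); split.
  - exact: undup_uniq.
  - by move=> k; rewrite mem_undup mem_cat => /orP[]; auto.
  - move=> k; rewrite mem_undup mem_cat negb_or => /andP[kl kl'] i.
    by rewrite V0 // V'0 // subr0.
  rewrite -(big_uniq_extend ul (undup_uniq _) sub); last first.
    by move=> k kl; rewrite big1 // => i _; rewrite V0 // tens0l.
  rewrite -(big_uniq_extend ul' (undup_uniq _) sub'); last first.
    by move=> k kl; rewrite big1 // => i _; rewrite V'0 // tens0l.
  rewrite -sumrB; apply: eq_bigr => k _; rewrite -sumrB; apply: eq_bigr => i _.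
  by rewrite tensBl.
move=> /(_ (Subgroup rep0 repB)); apply=> _ [x [y [/sm_pi_eq0 Sy ->]]] /=.
move: y Sy x; apply: gen_submodule_ind => [x|y y' Hy Hy' x|a _ [k [i [kgood ik ->]]] x].
- by rewrite tens0r.
- by rewrite tensBr; apply: repB.
rewrite -tensM; exists [:: k],
  (fun k' i' => if (k' == k) && (i' == i) then (a : opring R) *: x else 0).
split=> // [k'|k'|].
- by rewrite inE => /eqP->.
- by rewrite inE => /negPf-> i'.
rewrite big_seq1 (bigD1 (Ordinal ik)) //= !eqxx big1 ?addr0 // => i' ii'.
by rewrite -[i' == i :> nat]/(i' == Ordinal ik) (negPf ii') tens0l.
Qed.

(** Write the image of [t] as the sum of the [tens (V k i) (col k i)]. Its coordinates outside [M]
    are 0, and the one at (k, j) says that the [V k i] satisfy the j-th relation of the module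
    presented by [rel k]. So they are the images of its generators under a map into X, and the
    component in [M] exhibits [t] as a sum of images of elements of [L]. *)
Let g_ker (X : fpmod R) t : tmapr (fpmod_sort X) g t = 0 -> L X t.
Proof.
move=> /rep_ker[l [V [ul lgood V0 tE]]].
have -> : t = \sum_(k <- l) \sum_(i < ngen k) tens (V k i) (val k i).
  have -> : t = tmapr _ fst_N (tmapr _ inl_N t).
    by rewrite tmapr_comp -[LHS]tmapr_id; apply: tmapr_ext.
  rewrite tE.
  rewrite raddf_sum; apply: eq_bigr => k _; rewrite raddf_sum; apply: eq_bigr => i _.
  exact: tmaprE.
rewrite big_seq; apply: sg_mem_sum => k kl; have [Y [y [pr Ly]]] := lgood k kl.
have [|h hP] := @presentation_hom _ _ (fpmod_sort X) _ _ _ _ (V k) pr; last first.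
  have := LF h Ly; rewrite raddf_sum; congr (sg_mem (L X) _).
  by apply: eq_bigr => i _; rewrite tmaplE hP.
move=> j jk; have := congr1 (tmapr _ (coord k j)) tE.
rewrite tmapr_comp.
have -> : tmapr _ (coord k j \o inl_N : {linear _ -> _}) t = 0.
  by rewrite -(tmapr0 _ t); apply: tmapr_ext.
rewrite raddf_sum /=.
move=> /(congr1 (@tens_reg _ _)) /esym; rewrite raddf0 raddf_sum /= => t0.
rewrite -[RHS]t0.
rewrite (bigD1_seq k) //= [X in _ + X]big1 ?addr0 => [|k' kk'].
  rewrite !raddf_sum /=; apply: eq_bigr => i _.
  by rewrite tmaprE /= eqxx jk tens_regE.
rewrite !raddf_sum big1 //= => i _.
by rewrite tmaprE /= eq_sym (negPf kk') /= tens0r raddf0.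
Qed.

Lemma subfunctor_kernel : exists (N' : lmodType R) (f : {linear M -> N'}),
  forall (X : fpmod R) t, tmapr (fpmod_sort X) f t = 0 <-> L X t.
Proof. by exists (sm_quot S), g => X t; split; [apply: g_ker|apply: g_kills]. Qed.

End SubfunctorKernel.

Section Biproduct.
Variables (R : pzRingType).
Implicit Types (X : lmodType (opring R)) (M N P : lmodType R).

Fact inl_is_linear M N : linear (fun m : M => (m, 0 : N)).
Proof. by move=> a m m'; apply: pair_eqP; rewrite //= scaler0 addr0. Qed.
Definition inl_lin M N : {linear M -> (M * N)%type} := mk_linear (@inl_is_linear M N).

Fact inr_is_linear M N : linear (fun n : N => (0 : M, n)).
Proof. by move=> a m m'; apply: pair_eqP; rewrite //= scaler0 addr0. Qed.
Definition inr_lin M N : {linear N -> (M * N)%type} := mk_linear (@inr_is_linear M N).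

Definition fst_lin M N : {linear (M * N)%type -> M} := fst.
Definition snd_lin M N : {linear (M * N)%type -> N} := snd.

Fact pair_is_linear M N P (f : {linear P -> M}) (g : {linear P -> N}) :
  linear (fun p => (f p, g p)).
Proof. by move=> a p q; rewrite !linearP. Qed.
Definition pair_lin M N P (f : {linear P -> M}) (g : {linear P -> N}) :
  {linear P -> (M * N)%type} := mk_linear (pair_is_linear f g).

Fact copair_is_linear M N P (f : {linear M -> P}) (g : {linear N -> P}) :
  linear (fun p : (M * N)%type => f p.1 + g p.2).
Proof. by move=> a p q; rewrite !linearP /= scalerDr addrACA. Qed.
Definition copair_lin M N P (f : {linear M -> P}) (g : {linear N -> P}) :
  {linear (M * N)%type -> P} := mk_linear (copair_is_linear f g).

Lemma tmapr_pairE X M N (z : tensor X (M * N)%type) :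
  z = tmapr X (inl_lin M N) (tmapr X (fst_lin M N) z) +
      tmapr X (inr_lin M N) (tmapr X (snd_lin M N) z).
Proof.
rewrite !tmapr_comp -tmaprD -[LHS]tmapr_id; apply: tmapr_ext => -[m n].
by apply: pair_eqP; rewrite /= ?addr0 ?add0r.
Qed.

Lemma tmapr_pair_eq0 X M N (z : tensor X (M * N)%type) :
  tmapr X (fst_lin M N) z = 0 -> tmapr X (snd_lin M N) z = 0 -> z = 0.
Proof. by move=> z1 z2; rewrite (tmapr_pairE z) z1 z2 !raddf0 addr0. Qed.

Lemma tmapr_pair_exists X M N (t : tensor X M) (u : tensor X N) :
  exists z, tmapr X (fst_lin M N) z = t /\ tmapr X (snd_lin M N) z = u.
Proof.
have id_t := tmapr_id t; have id_u := tmapr_id u.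
exists (tmapr X (inl_lin M N) t + tmapr X (inr_lin M N) u).
rewrite !raddfD /= !tmapr_comp; split.
  rewrite -[RHS]id_t -[RHS]addr0 -(tmapr0 M u).
  by congr (_ + _); apply: tmapr_ext.
rewrite -[RHS]id_u -[RHS]add0r -(tmapr0 N t).
by congr (_ + _); apply: tmapr_ext.
Qed.

End Biproduct.

Section Regular.
Variable R : pzRingType.

Lemma regular_fp : finitely_presented ((opring R)^o : lmodType (opring R)).
Proof.
pose S := opring R.
have p_lin : linear (fun v : 'rV[S]_1 => v 0 0 : S^o).
  by move=> a u v; rewrite !mxE.
exists 0, 1%N, \0, (mk_linear p_lin); split=> [x|v].
  by exists (\row_i x); rewrite /= mxE.
split=> [v0|[u <-]]; last by rewrite /= mxE.
by exists 0; apply/rowP => i; rewrite (ord1 i) /= mxE; apply/esym.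
Qed.

Definition regular : fpmod R := exist _ ((opring R)^o : lmodType (opring R)) regular_fp.

Fact regular_tens_balanced (M : lmodType R) :
  balanced (fun (r : (opring R)^o) (m : M) => (r : R) *: m).
Proof.
split=> [r s m|r m n|s r m]; [exact: scalerDl|exact: scalerDr|].
by rewrite scalerA.
Qed.

Lemma tens1_inj (M : lmodType R) (m n : M) :
  tens (1 : fpmod_sort regular) m = tens (1 : fpmod_sort regular) n -> m = n.
Proof.
move=> /(congr1 (tensor_lift (@regular_tens_balanced M))).
by rewrite !tensor_liftE !scale1r.
Qed.

End Regular.

Section Extension.
Variable R : pzRingType.
Hypothesis Rpss : left_pure_semisimple R.
Implicit Types M N P : lmodType R.

(** [M] itself is pure-injective, so its identity extends along [f]. *)
Lemma fin_pure_retract M N (f : {linear M -> N}) : fin_pure f ->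
  exists r : {linear N -> M}, forall m, r (f m) = m.
Proof. by move=> pf; exact: Rpss (idfun : {linear M -> M}) (fin_pure_pure_mono pf). Qed.

(* A subfunctor of [-(x)(P * M)] that is the graph of a partial map from      *)
(* [-(x)P] to [-(x)M]: the cokernel of its embedding receives [M] purely.     *)
Lemma graph_extend P M
    (L : forall X : fpmod R, subgroup (tensor (fpmod_sort X) (P * M)%type)) :
  (forall (X Y : fpmod R) (h : {linear fpmod_sort X -> fpmod_sort Y}) t,
    L X t -> L Y (tmapl _ h t)) ->
  (forall X z, L X z -> tmapr _ (fst_lin P M) z = 0 -> tmapr _ (snd_lin P M) z = 0) ->
  exists f : {linear P -> M}, forall X z, L X z ->
    tmapr _ (snd_lin P M) z = tmapr _ f (tmapr _ (fst_lin P M) z).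
Proof.
move=> LF Lfun; have [N [g gL]] := subfunctor_kernel LF.
(* If (0, t) dies in the cokernel it lies in [L], so [t] is 0 because [L] is a graph. *)
have [|r rP] := @fin_pure_retract M N (g \o inr_lin P M : {linear _ -> _}).
  apply: fp_mono_fin_pure => X t fpX; pose Xf : fpmod R := exist _ X fpX.
  have fst0 : tmapr X (fst_lin P M) (tmapr X (inr_lin P M) t) = 0.
    by rewrite tmapr_comp -(tmapr0 P t); apply: tmapr_ext.
  rewrite -tmapr_comp => /(gL Xf)/Lfun/(_ fst0) <-.
  by rewrite tmapr_comp -[LHS]tmapr_id; apply: tmapr_ext.
(* Applying [r] to [g z = 0] gives that [r g] of the first component plus the second component is 0,
   whence the sign. *)
exists (\- (r \o (g \o inl_lin P M)) : {linear _ -> _}) => X z Lz.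
have := congr1 (tmapr (fpmod_sort X) r) ((gL X z).2 Lz).
rewrite {1}(tmapr_pairE z) !raddfD raddf0 /= tmaprN !tmapr_comp.
move=> /eqP; rewrite addrC addr_eq0 => /eqP rsnd.
rewrite (_ : tmapr _ (snd_lin P M) z =
  tmapr _ ((r \o g) \o (inr_lin P M \o snd_lin P M)) z).
  by rewrite rsnd; congr (- _); apply: tmapr_ext.
by apply: tmapr_ext => p; rewrite /= rP.
Qed.

(** The image of - tensor (k, k') is a graph, by the inclusion of kernels. The map extending it is
    compared with [k'] on the regular module, where tensoring recovers the elements of the
    module. *)
Lemma tensor_factor P M N (k : {linear P -> M}) (k' : {linear P -> N}) :
  (forall (X : fpmod R) (t : tensor (fpmod_sort X) P),
    tmapr _ k t = 0 -> tmapr _ k' t = 0) ->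
  exists f : {linear M -> N}, forall p, k' p = f (k p).
Proof.
move=> kk'; pose kk := pair_lin k k'.
pose im (X : lmodType (opring R)) (z : tensor X (M * N)%type) :=
  exists t, z = tmapr X kk t.
have im0 X : im X 0 by exists 0; rewrite raddf0.
have imB X z z' : im X z -> im X z' -> im X (z - z').
  by move=> [t ->] [t' ->]; exists (t - t'); rewrite raddfB.
have fstE X t : tmapr X (fst_lin M N) (tmapr X kk t) = tmapr X k t.
  by rewrite tmapr_comp; apply: tmapr_ext.
have sndE X t : tmapr X (snd_lin M N) (tmapr X kk t) = tmapr X k' t.
  by rewrite tmapr_comp; apply: tmapr_ext.
have [||f fP] := @graph_extend M N (fun X => Subgroup (@im0 (fpmod_sort X)) (@imB _)).
- by move=> X Y h _ [t ->]; exists (tmapl _ h t); rewrite tmaplr.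
- by move=> X _ [t ->]; rewrite fstE sndE; apply: kk'.
exists f => p; apply: tens1_inj.
have := fP (regular R)
  (tmapr (fpmod_sort (regular R)) kk (tens (1 : fpmod_sort (regular R)) p)).
rewrite fstE sndE !tmaprE; apply.
by exists (tens (1 : fpmod_sort (regular R)) p); rewrite tmaprE.
Qed.

End Extension.

(** * Embedding functors in tensor functors *)

Section FunctorsToAb.
Variables (C : preadditive) (F : functor C Ab).

Lemma fmap_comp_app x y z (g : hom y z) (f : hom x y) (a : F x) :
  fmap F (comp g f) a = fmap F g (fmap F f a).
Proof. exact: (congr1 (fun k : {additive _ -> _} => k a) (fmapM F g f)). Qed.

Lemma fmap_id_app x (a : F x) : fmap F (idm x) a = a.
Proof. exact: (congr1 (fun k : {additive _ -> _} => k a) (fmap1 F x)). Qed.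

Lemma fmap_0_app x y (a : F x) : fmap F (hom0 x y) a = 0.
Proof. exact: (congr1 (fun k : {additive _ -> _} => k a) (fmap0 F x y)). Qed.

Lemma fmap_sub_app x y (f g : hom x y) (a : F x) :
  fmap F (hom_add f (hom_opp g)) a = fmap F f a - fmap F g a.
Proof.
have add (h k : hom x y) : fmap F (hom_add h k) a = fmap F h a + fmap F k a.
  exact: (congr1 (fun l : {additive _ -> _} => l a) (fmapD F h k)).
apply: (addIr (fmap F g a)); rewrite subrK -add -hom_addA hom_addN.
by rewrite hom_addC hom_add0.
Qed.

End FunctorsToAb.

Lemma dependent_update (K : Type) (T : K -> Type) (f : forall k, T k) (k : K)
    (t : T k) :
  exists g : forall k, T k, g k = t /\ forall k', k' <> k -> g k' = f k'.
Proof.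
exists (fun k' => match pselect (k = k') with
  | left e => eq_rect k T t k' e | right _ => f k' end).
split=> [|k' k'k]; case: pselect => // e; first by rewrite (Prop_irrelevance e erefl).
by case: k'k.
Qed.

Section FunctorEmbedding.
Variables (R : pzRingType) (F : functor (fpmod R) Ab).

(* [fpmod R] is too large to index the generators of a module. *)
Let skeleton : Type := (nat * nat * (nat -> nat -> R))%type.

Lemma skeleton_repr (k : skeleton) : exists p : {X : fpmod R & nat -> fpmod_sort X},
  presentation k.1.1 k.1.2 (tagged p) k.2.
Proof.
have [X [x [fpX pr]]] := presentation_coker k.1.1 k.1.2 k.2.
by exists (existT (fun X : fpmod R => nat -> fpmod_sort X) (exist _ X fpX) x).
Qed.

Let mdl (k : skeleton) : fpmod R := tag (projT1 (cid (skeleton_repr k))).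
Let gen (k : skeleton) : nat -> fpmod_sort (mdl k) :=
  tagged (projT1 (cid (skeleton_repr k))).
Let gen_pres k : presentation k.1.1 k.1.2 (gen k) k.2 :=
  projT2 (cid (skeleton_repr k)).

Let K : Type := {classic {k : skeleton & F (mdl k)}}.
Let N : lmodType R := (K -> nat -> R^o).

Fact coord_is_linear (k : K) (i : nat) : linear (fun w : N => w k i).
Proof. by []. Qed.
Let coord k i : {linear N -> R^o} := mk_linear (coord_is_linear k i).

Let basis (k : K) (i : nat) : N := fun k' i' => ((k' == k) && (i' == i))%:R.

(* The universal element of [mdl k (x) N] standing for [tagged k : F (mdl k)]. *)
Let univ (k : K) : tensor (fpmod_sort (mdl (tag k))) N :=
  \sum_(i < (tag k).1.1) tens (gen (tag k) i) (basis k i).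

(** The elements [univ k] generate a subfunctor of - tensor N. This relation is the graph of the
    transformation from it onto [F] that sends [univ k] to the element of [F] carried by [k]. *)
Let rep (Y : fpmod R) (u : tensor (fpmod_sort Y) N) (b : F Y) :=
  exists (l : seq K) (H : forall k : K, hom (mdl (tag k)) Y),
    [/\ uniq l, forall k, k \notin l -> H k = hom0 _ _,
        u = \sum_(k <- l) tmapl N (H k) (univ k)
      & b = \sum_(k <- l) fmap F (H k) (tagged k)].

Let rep00 Y : @rep Y 0 0.
Proof. by exists [::], (fun k => hom0 _ _); rewrite !big_nil. Qed.

Let repB Y u u' b b' : @rep Y u b -> rep u' b' -> rep (u - u') (b - b').
Proof.
move=> [l [H [ul H0 -> ->]]] [l' [H' [ul' H'0 -> ->]]].
have sub : {subset l <= undup (l ++ l')}.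
  by move=> k kl; rewrite mem_undup mem_cat kl.
have sub' : {subset l' <= undup (l ++ l')}.
  by move=> k kl; rewrite mem_undup mem_cat kl orbT.
have zero (G : functor (fpmod R) Ab) k (a : G (mdl (tag k))) :
    k \notin l -> fmap G (H k) a = 0 by move/H0 ->; apply: fmap_0_app.
have zero' (G : functor (fpmod R) Ab) k (a : G (mdl (tag k))) :
    k \notin l' -> fmap G (H' k) a = 0 by move/H'0 ->; apply: fmap_0_app.
exists (undup (l ++ l')), (fun k => hom_add (H k) (hom_opp (H' k))); split.
- exact: undup_uniq.
- move=> k; rewrite mem_undup mem_cat negb_or => /andP[/H0 -> /H'0 ->].
  by rewrite hom_addC hom_addN.
- rewrite -(big_uniq_extend ul (undup_uniq _) sub) => [|k];
    last exact: (zero (tensor_obj N)).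
  rewrite -(big_uniq_extend ul' (undup_uniq _) sub') => [|k];
    last exact: (zero' (tensor_obj N)).
  rewrite -sumrB; apply: eq_bigr => k _.
  exact/esym/(fmap_sub_app (F := tensor_obj N)).
- rewrite -(big_uniq_extend ul (undup_uniq _) sub) => [|k]; last exact: zero.
  rewrite -(big_uniq_extend ul' (undup_uniq _) sub') => [|k]; last exact: zero'.
  by rewrite -sumrB; apply: eq_bigr => k _; rewrite fmap_sub_app.
Qed.

Let rep_fmap (X Y : fpmod R) (h : hom X Y) u b :
  rep u b -> rep (tmapl N (h : {linear fpmod_sort X -> fpmod_sort Y}) u) (fmap F h b).
Proof.
move=> [l [H [ul H0 -> ->]]]; exists l, (fun k => comp h (H k)); split=> //.
- by move=> k /H0->; apply: compm0.
- by rewrite raddf_sum; apply: eq_bigr => k _; rewrite tmapl_comp.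
- by rewrite raddf_sum; apply: eq_bigr => k _; rewrite fmap_comp_app.
Qed.

(** The [univ k] are independent: the coordinate (k, i) of the tensor is [H k] at the i-th
    generator, so all the [H k] on the list vanish. *)
Let rep0_eq0 Y b : @rep Y 0 b -> b = 0.
Proof.
move=> [l [H [ul H0 u0 ->]]]; rewrite big_seq big1 // => k kl.
rewrite (_ : H k = hom0 _ _) ?fmap_0_app //.
apply: (presentation_hom_eq (h' := \0) (gen_pres (tag k))) => i ik.
move/esym/(congr1 (tmapr _ (coord k i)))/(congr1 (@tens_reg _ _)): u0.
rewrite !raddf0 !raddf_sum (bigD1_seq k) //= [X in _ + X]big1 ?addr0 => [|k' kk'].
  move=> <-; rewrite -tmaplr !raddf_sum (bigD1 (Ordinal ik)) //=.
  rewrite [X in _ + X]big1 ?addr0 => [|j ij].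
    by rewrite !(tmaprE, tmaplE) tens_regE /= /basis !eqxx scale1r.
  rewrite !(tmaprE, tmaplE) tens_regE /= /basis.
  rewrite -[i == j :> nat]/(Ordinal ik == j) eq_sym (negPf ij) andbF.
  exact: scale0r.
rewrite -tmaplr !raddf_sum big1 //= => j _.
by rewrite !(tmaprE, tmaplE) tens_regE /= /basis eq_sym (negPf kk') scale0r.
Qed.

(** [Y] shares a presentation with some [mdl k], so each element of [F Y] is the image of an element
    of [F (mdl k)]. *)
Let rep_exists (Y : fpmod R) (b : F Y) : exists u, rep u b.
Proof.
have [n [m [y [A pr]]]] := presentation_fp (svalP Y).
pose k : skeleton := (n, m, A); have prk : presentation n m (gen k) A := gen_pres k.
have [h hE] : exists h : {linear fpmod_sort (mdl k) -> fpmod_sort Y},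
    forall i, (i < n)%N -> h (gen k i) = y i.
  by apply: presentation_hom prk _ => j jm; apply: presentation_rel pr jm.
have [h' h'E] : exists h : {linear fpmod_sort Y -> fpmod_sort (mdl k)},
    forall i, (i < n)%N -> h (y i) = gen k i.
  by apply: presentation_hom pr _ => j jm; apply: presentation_rel prk jm.
have hh' : comp (h : hom (mdl k) Y) (h' : hom Y (mdl k)) = idm Y.
  apply: (presentation_hom_eq pr) => i ni.
  by rewrite -[LHS]/(h (h' (y i))) h'E // hE.
pose kb : K := Tagged (fun k => F (mdl k)) (fmap F (h' : hom Y (mdl k)) b).
have [H [Hkb H0]] := @dependent_update K (fun k => hom (mdl (tag k)) Y)
  (fun=> hom0 _ _) kb h.
exists (\sum_(k <- [:: kb]) tmapl N (H k) (univ k)), [:: kb], H; split=> //.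
  by move=> k'; rewrite inE => /eqP /H0.
by rewrite big_seq1 Hkb -fmap_comp_app hh' fmap_id_app.
Qed.

(** [F] is a quotient of the subfunctor generated by the [univ k]. The elements representing 0 form
    a subfunctor of - tensor N, hence the kernel of some - tensor g. Applying [g] to any
    representative of an element of [F] embeds [F] in - tensor B. *)
Lemma functor_embedding : exists (B : lmodType R)
    (e : forall X : fpmod R, {additive F X -> tensor (fpmod_sort X) B}),
  (forall X a, e X a = 0 -> a = 0) /\
  forall (X Y : fpmod R) (h : hom X Y) a,
    e Y (fmap F h a) = tmapl B (h : {linear fpmod_sort X -> fpmod_sort Y}) (e X a).
Proof.
have rel0 (X : fpmod R) u u' : @rep X u 0 -> rep u' 0 -> rep (u - u') 0.
  by move=> ru ru'; rewrite -(subr0 0); apply: repB.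
have relF (X Y : fpmod R) (h : {linear fpmod_sort X -> fpmod_sort Y}) u :
    @rep X u 0 -> @rep Y (tmapl N h u) 0.
  by move/(rep_fmap (h : hom X Y)); rewrite raddf0.
pose L (X : fpmod R) := @Subgroup (tensor (fpmod_sort X) N) (fun u => rep u 0)
  (rep00 X) (@rel0 X).
have [B [g gP]] := @subfunctor_kernel R N L relF.
pose r X (b : F X) := projT1 (cid (rep_exists b)).
have rP X b : rep (@r X b) b := projT2 (cid (rep_exists b)).
have gE X u b : rep u b -> tmapr (fpmod_sort X) g u = tmapr _ g (r X b).
  move=> ub; apply/eqP; rewrite -subr_eq0 -raddfB; apply/eqP/gP.
  by rewrite /= -(subrr b); apply: repB.
have e_add X : zmod_morphism (fun b : F X => tmapr (fpmod_sort X) g (r X b)).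
  by move=> b b'; rewrite -raddfB -(gE X _ _ (repB (rP X b) (rP X b'))).
exists B, (fun X => mk_additive (@e_add X)); split=> [X b /= /gP /= r0|X Y h b /=].
  by apply: rep0_eq0; have := repB (rP X b) r0; rewrite subrr subr0.
by rewrite tmaplr -(gE _ _ _ (rep_fmap h (rP X b))).
Qed.

End FunctorEmbedding.

(** * Quasi-Frobenius rings *)

Section AnnihilatorConditions.
Variable S : pzRingType.

(* Otherwise the left annihilators of longer and longer lists in [T] would    *)
(* strictly decrease forever.                                                 *)
Lemma artinian_annihilator (T : S -> Prop) : artinian_module (S^o : lmodType S) ->
  exists c : seq S, (forall y, y \in c -> T y) /\
    forall x u, T x -> (forall y, y \in c -> u * y = 0) -> u * x = 0.
Proof.
move=> artS; apply: contrapT => noc.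
have step (c : seq S) : exists x, (forall y, y \in c -> T y) ->
    T x /\ exists u, (forall y, y \in c -> u * y = 0) /\ u * x <> 0.
  have [cT|] := pselect (forall y, y \in c -> T y); last by exists 0.
  apply: contrapT => nox; apply: noc; exists c; split=> // x u Tx uc.
  by apply: contrapT => ux; apply: nox; exists x => _; split=> //; exists u.
have [f fP] := choice step.
pose chain k := iter k (fun c => f c :: c) [::].
have chainT k y : y \in chain k -> T y.
  elim: k y => //= k IH y; rewrite inE => /orP[/eqP->|]; last exact: IH.
  by have [] := fP _ IH.
pose A k (u : S^o) := forall y, y \in chain k -> u * y = 0.
have [||n /(_ n.+1 _ (leqnSn n)) An] := artS A.
- move=> k; split=> [y _|a u v Au Av y yk]; first by rewrite mul0r.
  by rewrite mulrDl -mulrA Au // Av // mulr0 addr0.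
- by move=> k u Au y yk; apply: Au; rewrite inE yk orbT.
have [_ [u [Anu ufu]]] := fP _ (chainT n).
by apply: ufu; apply: ((An u).2 Anu); rewrite inE eqxx.
Qed.

(** The map sending (u c_i)_i to u x is well defined on a submodule of the free module of rank n and
    extends to all of it; its values on the unit vectors are the coefficients. *)
Lemma injective_annihilator (n : nat) (c : nat -> S) (x : S) :
  injective_module (S^o : lmodType S) ->
  (forall u, (forall i, (i < n)%N -> u * c i = 0) -> u * x = 0) ->
  exists d : nat -> S, x = \sum_(i < n) c i * d i.
Proof.
move=> injS cx.
have k_lin : linear (fun (u : S^o) (i : 'I_n) => u * c i : S^o).
  by move=> a u v; apply/funext => i; rewrite mulrDl -mulrA.
have f_lin : linear (fun u : S^o => u * x : S^o).
  by move=> a u v; rewrite mulrDl -mulrA.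
have [|g gk] := injective_extend (k := mk_linear k_lin) (f := mk_linear f_lin) injS.
  by move=> u ku; apply: cx => i ni; apply: (congr1 (fun w => w (Ordinal ni)) ku).
pose e (i : 'I_n) : 'I_n -> S^o := fun j => (j == i)%:R.
exists (fun i => if insub i is Some j then g (e j) else 0).
have := gk 1; rewrite /= mul1r => <-.
have -> : (fun i : 'I_n => 1 * c i : S^o) = \sum_(i < n) c i *: e i.
  apply/funext => j; rewrite fct_sumE (bigD1 j) //= big1 ?addr0 => [|i ij].
    by rewrite -[RHS]/(c j * (j == j)%:R) eqxx mulr1 mul1r.
  by rewrite -[LHS]/(c i * (j == i)%:R) eq_sym (negPf ij) mulr0.
by rewrite linear_sum; apply: eq_bigr => i _; rewrite linearZZ valK.
Qed.

(** Take finitely many [c] annihilating [y] with the same right annihilator as the whole annihilator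
    of [y]. If all products [c u] vanish, sending a y to a u is well defined and extends to a map on
    [Y] with value [u] at [y], so [u = 0]. Then 1 is a left combination of the [c], and [y = 0]. The
    two annihilator hypotheses belong to the opposite ring; they are written with products of [S] so
    that the lemma serves both sides. *)
Lemma cogenerator (Y : lmodType S) (y : Y) :
  injective_module (S^o : lmodType S) ->
  (forall T : S -> Prop, exists c : seq S, (forall y, y \in c -> T y) /\
    forall x u, T x -> (forall y, y \in c -> y * u = 0) -> x * u = 0) ->
  (forall n (c : nat -> S),
    (forall u, (forall i, (i < n)%N -> c i * u = 0) -> 1 * u = 0) ->
    exists d : nat -> S, 1 = \sum_(i < n) d i * c i) ->
  (forall f : {linear Y -> S^o}, f y = 0) -> y = 0.
Proof.
move=> injS annS unitS fy.
have [c [cT cann]] := annS (fun a => a *: y = 0).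
have [|d dc] := unitS (size c) (fun i => nth 0 c i); last first.
  rewrite -[y]scale1r dc scaler_suml big1 // => i _.
  by rewrite -scalerA cT ?scaler0 // mem_nth.
move=> u cu; rewrite mul1r.
have k_lin : linear (fun a : S^o => (a : S) *: y).
  by move=> a b b'; rewrite scalerDl scalerA.
have f_lin : linear (fun a : S^o => a * u : S^o).
  by move=> a b b'; rewrite mulrDl -mulrA.
have [|g gk] := injective_extend (k := mk_linear k_lin) (f := mk_linear f_lin) injS.
  move=> a ay; apply: cann ay _ => z zc.
  by rewrite -(nth_index 0 zc) cu // index_mem.
by have := gk 1; rewrite /= scale1r mul1r => <-.
Qed.

End AnnihilatorConditions.

Section QuasiFrobenius.
Variable R : pzRingType.
Hypothesis RQF : quasi_frobenius R.

Lemma QF_cogenerator_left (Y : lmodType R) (y : Y) :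
  (forall f : {linear Y -> R^o}, f y = 0) -> y = 0.
Proof.
have [_ artr injl injr] := RQF; apply: cogenerator => //.
  by move=> T; apply: (@artinian_annihilator (opring R) T artr).
by move=> n c; apply: (@injective_annihilator (opring R) n c 1 injr).
Qed.

Lemma QF_cogenerator_right (Y : lmodType (opring R)) (y : Y) :
  (forall f : {linear Y -> (opring R)^o}, f y = 0) -> y = 0.
Proof.
have [artl _ injl injr] := RQF; apply: cogenerator => //.
  by move=> T; apply: (@artinian_annihilator R T artl).
by move=> n c; apply: (@injective_annihilator R n c 1 injl).
Qed.

(** By the left chain condition some finite part of [T] has the same left annihilator as [T]; by
    left self-injectivity it then generates every element of [T] on the right. *)
Lemma QF_right_noetherian (T : R -> Prop) : exists n (c : nat -> R),
  (forall i, (i < n)%N -> T (c i)) /\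
  forall x, T x -> exists d : nat -> R, x = \sum_(i < n) c i * d i.
Proof.
have [artl _ injl _] := RQF; have [c [cT cann]] := artinian_annihilator T artl.
exists (size c), (nth 0 c); split=> [i ic|x Tx]; first by apply: cT; rewrite mem_nth.
apply: injective_annihilator => // u uc; apply: cann Tx _ => y yc.
by rewrite -(nth_index 0 yc) uc // index_mem.
Qed.

(** Induction on the number of coordinates: generators for the vectors of [K] with last coordinate 0
    are joined to lifts of generators for the last coordinates. *)
Lemma QF_right_noetherian_vectors (p : nat) (K : (nat -> R) -> Prop) :
  K 0 -> (forall v w, K v -> K w -> K (v - w)) ->
  (forall v r, K v -> K (fun j => v j * r)) ->
  exists n (C : nat -> nat -> R), (forall l, (l < n)%N -> K (C l)) /\
    forall v, K v -> exists d : nat -> R,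
      forall j, (j < p)%N -> v j = \sum_(l < n) C l j * d l.
Proof.
elim: p K => [|p IH] K K0 KB KM.
  by exists 0, (fun _ => 0); split=> // v _; exists (fun=> 0).
have [||| n [C [KC Cgen]]] := IH (fun v => K v /\ v p = 0).
- by [].
- move=> v w [Kv vp] [Kw wp]; split; first exact: KB.
  by rewrite -[LHS]/(v p - w p) vp wp subrr.
- by move=> v r [Kv vp]; split; [apply: KM|rewrite vp mul0r].
have [m [c [cK cgen]]] := QF_right_noetherian (fun r => exists v, K v /\ v p = r).
have [D DP] : exists D : nat -> nat -> R, forall i, (i < m)%N -> K (D i) /\ D i p = c i.
  have /choice[D DP] : forall i, exists v, (i < m)%N -> K v /\ v p = c i.
    move=> i; have [im|_] := ltnP i m; last by exists 0.
    by have [v [Kv vp]] := cK i im; exists v.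
  by exists D.
exists (n + m)%N, (fun l => if (l < n)%N then C l else D (l - n)%N); split.
  move=> l lnm; case: ltnP => nl; first by case: (KC l nl).
  by case: (DP (l - n)%N); rewrite ?ltn_subLR.
move=> v Kv; have [|d vd] := cgen (v p); first by exists v.
pose w := v - \sum_(i < m) (fun j => D i j * d i).
have wE j : w j = v j - \sum_(i < m) D i j * d i.
  by rewrite -[LHS]/(v j - _ j) fct_sumE.
have Kw : K w.
  apply: (KB _ _ Kv); elim/big_ind: _ => [//|u u' Ku Ku'|i _].
    by rewrite -(opprK u') -(sub0r u'); apply: (KB) => //; apply: (KB).
  by apply: KM; case: (DP i (ltn_ord i)).
have wp : w p = 0.
  rewrite wE vd; apply/eqP; rewrite subr_eq0; apply/eqP.
  by apply: eq_bigr => i _; have [_ ->] := DP i (ltn_ord i).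
have [//|d' wd'] := Cgen w.
exists (fun l => if (l < n)%N then d' l else d (l - n)%N) => j; rewrite ltnS => jp.
rewrite big_split_ord /=.
under eq_bigr do rewrite ltn_ord.
under [X in _ + X]eq_bigr do rewrite ltnNge leq_addr /= addKn.
have wj : w j = \sum_(l < n) C l j * d' l.
  move: jp; rewrite leq_eqVlt => /orP[/eqP->|]; last exact: wd'.
  by rewrite wp big1 // => i _; have [_ ->] := KC i (ltn_ord i); rewrite mul0r.
by rewrite -wj wE subrK.
Qed.

End QuasiFrobenius.

Section Corestriction.
Variables (R : pzRingType) (M N : lmodType R) (S : submodule N) (f : {linear M -> N}).
Hypothesis Sf : forall x, S (f x).

Fact sm_cores_is_linear : linear (fun x => sm_in (Sf x)).
Proof. by move=> a x y; apply: sm_val_inj; rewrite [RHS]linearP; apply: linearP. Qed.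
Definition sm_cores : {linear M -> sm_type S} := mk_linear sm_cores_is_linear.
End Corestriction.

(** * Modules whose tensors are separated by maps to R, and free covers *)

Section SeparatedModules.
Variable R : pzRingType.
Implicit Types (X Y : lmodType (opring R)) (N : lmodType R).

Fact eval_is_linear (I : Type) N (i : I) : linear (fun w : I -> N => w i).
Proof. by []. Qed.
Definition eval_lin (I : Type) N (i : I) : {linear (I -> N) -> N} :=
  mk_linear (@eval_is_linear I N i).

Lemma tens_reg_natural X Y (h : {linear X -> Y}) t :
  h (tens_reg X t) = tens_reg Y (tmapl R^o h t).
Proof.
apply: (congr1 (fun k : {additive _ -> _} => k t)
  (x := (h \o @tens_reg R X : {additive _ -> _}))
  (y := (@tens_reg R Y \o tmapl R^o h : {additive _ -> _}))).
by apply: tensor_ext => x m; rewrite /= tmaplE !tens_regE linearZZ.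
Qed.

(** Since R is projective, for such [N] a tensor killed by all maps to projectives is 0: the stable
    part of - tensor N is trivial. *)
Definition separated N := forall X, finitely_presented X ->
  forall t : tensor X N,
    (forall h : {linear X -> (opring R)^o}, tmapl N h t = 0) -> t = 0.

(* Generated by the [gen n], whose first components make them independent.     *)
Section FreeCover.
Variable N : lmodType R.

Let gen (n : N) : ((N -> R^o) * N)%type := (fun n' => (n' == n)%:R, n).

Let F := gen_submodule (fun y => exists n, y = gen n).

Lemma gen_in n : F (gen n). Proof. by apply: gen_submodule_gen; exists n. Qed.

Definition free_cover : lmodType R := sm_type F.

Definition free_cover_map : {linear free_cover -> N} := snd_lin _ _ \o sm_val F.

Lemma free_cover_surj n : exists x, free_cover_map x = n.
Proof. by exists (sm_in (gen_in n)). Qed.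

Let tens_free X (t : tensor X free_cover) := exists (l : seq N) (V : N -> X),
  [/\ uniq l, forall n, n \notin l -> V n = 0
    & t = \sum_(n <- l) tens (V n) (sm_in (gen_in n))].

Lemma free_cover_tens X (t : tensor X free_cover) : tens_free t.
Proof.
have S0 : @tens_free X 0 by exists [::], (fun=> 0); rewrite big_nil.
have SB u v : @tens_free X u -> tens_free v -> tens_free (u - v).
  move=> [l [V [ul V0 ->]]] [l' [V' [ul' V'0 ->]]].
  have sub : {subset l <= undup (l ++ l')}.
    by move=> k kl; rewrite mem_undup mem_cat kl.
  have sub' : {subset l' <= undup (l ++ l')}.
    by move=> k kl; rewrite mem_undup mem_cat kl orbT.
  exists (undup (l ++ l')), (fun n => V n - V' n); split; first exact: undup_uniq.
    move=> n; rewrite mem_undup mem_cat negb_or => /andP[/V0-> /V'0->].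
    exact: subr0.
  rewrite -(big_uniq_extend ul (undup_uniq _) sub) => [|n /V0->]; last exact: tens0l.
  rewrite -(big_uniq_extend ul' (undup_uniq _) sub') => [|n /V'0->]; last exact: tens0l.
  by rewrite -sumrB; apply: eq_bigr => n _; rewrite tensBl.
apply: (tensor_ind (S := Subgroup S0 SB)) => x p /=.
(* The induction on generated elements runs in the ambient product, so the claim speaks of some
   member of [free_cover] with the given value. *)
suff [p' [pp' Hp']] :
    exists p' : free_cover,
      sm_val F p' = sm_val F p /\ forall x : X, tens_free (tens x p').
  rewrite (_ : p = p'); first exact: Hp'.
  exact: sm_val_inj (esym pp').
move: (sm_val F p) (sm_valP p) => {x p}.
apply: (@gen_submodule_ind _ _ _ (fun y => exists p', sm_val F p' = y /\
  forall x, tens_free (tens x p'))) => [|_ _ [p [<- Hp]] [q [<- Hq]]|a _ [n ->]].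
- by exists 0; split=> [|x]; rewrite ?linear0 // tens0r.
- by exists (p - q); split=> [|x]; rewrite ?linearB // tensBr; apply: SB.
- exists (a *: sm_in (gen_in n)); split=> [|x]; first by rewrite linearZZ.
  rewrite -tensM; exists [:: n], (fun m => if m == n then (a : opring R) *: x else 0).
  split=> // [m|]; first by rewrite inE => /negPf->.
  by rewrite big_seq1 eqxx.
Qed.

Lemma free_cover_eq0 X (l : seq N) (V : N -> X) : uniq l ->
  \sum_(n <- l) tens (V n) (sm_in (gen_in n)) = 0 -> forall n, n \in l -> V n = 0.
Proof.
move=> ul t0 n nl.
have := congr1 (tmapr X (eval_lin _ n \o (fst_lin _ _ \o sm_val F)
  : {linear free_cover -> R^o})) t0.
move/(congr1 (@tens_reg R X)); rewrite !raddf0 !raddf_sum => <-.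
rewrite (bigD1_seq n) //= [X in _ + X]big1 ?addr0 => [|n' nn'].
  by rewrite tmaprE /= tens_regE eqxx scale1r.
by rewrite tmaprE /= tens_regE eq_sym (negPf nn') scale0r.
Qed.

End FreeCover.

End SeparatedModules.

Section QuasiFrobenius.
Variable R : pzRingType.
Hypothesis RQF : quasi_frobenius R.

(** The coordinates of [t] in the basis are elements of X, and maps to R separate these. *)
Lemma separated_free_cover (N : lmodType R) : separated (free_cover N).
Proof.
move=> X fpX t th; have [l [V [ul V0 tE]]] := free_cover_tens t.
rewrite tE big_seq big1 // => n nl; rewrite (_ : V n = 0) ?tens0l //.
apply: (QF_cogenerator_right RQF) => h.
apply: (free_cover_eq0 (V := fun n => h (V n)) ul _ nl).
rewrite -[RHS](th h) tE raddf_sum; apply: eq_bigr => m _.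
by rewrite /= tmaplE.
Qed.

(** Each coordinate of [t] is an element of X, which is 0 since maps to R separate elements of X.
    The coefficients at that coordinate are thus combinations of the finitely many relations of X,
    and the multipliers chosen at all coordinates assemble into elements of the product. *)
Lemma separated_product (I : Type) : separated (I -> R^o : lmodType R).
Proof.
move=> X fpX t th; have [n [m [x [A pr]]]] := presentation_fp fpX.
have [w tE] := presentation_tens t pr.
have /choice[u uP] : forall i, exists u : nat -> R,
    forall k, (k < n)%N -> w k i = \sum_(j < m) A j k * u j.
  move=> i; apply/(pr.2 (fun k => w k i : R)).
  have -> : \sum_(k < n) ((w k i : R) : opring R) *: x k =
      tens_reg X (tmapr X (eval_lin _ i) t).
    rewrite tE !raddf_sum; apply: eq_bigr => k _.
    by rewrite /= tmaprE tens_regE.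
  apply: (QF_cogenerator_right RQF) => h.
  by rewrite tens_reg_natural tmaplr th !raddf0.
rewrite tE; apply/(presentation_tens_eq0 w pr); exists (fun j i => u i j) => k kn.
by apply/funext => i; rewrite uP // fct_sumE.
Qed.

Hypothesis Rpss : left_pure_semisimple R.

(* The kernel of the pullback of [p] along [f] is pure because the solutions  *)
(* of a homogeneous system over [R] are finitely generated, uniformly in [I]. *)
Lemma product_lift (I : Type) (M N : lmodType R) (p : {linear M -> N})
    (f : {linear (I -> R^o) -> N}) : (forall y, exists x, p x = y) ->
  exists g : {linear (I -> R^o) -> M}, forall w, p (g w) = f w.
Proof.
move=> psurj; pose D := ker_submodule (copair_lin p (\- f : {linear _ -> _})).
have DE (y : (M * (I -> R^o))%type) : D y <-> p y.1 = f y.2.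
  by split=> [/eqP|py]; [rewrite /= subr_eq0 => /eqP|rewrite /= py subrr].
have kD (k : sm_type (ker_submodule p)) :
    D (inl_lin M (I -> R^o) (sm_val (ker_submodule p) k)).
  by apply/DE; rewrite /= (linear0 f); exact: (sm_valP k).
pose i := sm_cores (f := inl_lin M (I -> R^o) \o sm_val (ker_submodule p)) kD.
have [|r rP] := @fin_pure_retract R Rpss _ _ i.
  move=> n m A b c bc; pose y j := (sm_val D (c j)).1; pose w j := (sm_val D (c j)).2.
  have yw j : p (y j) = f (w j) by apply/DE/sm_valP.
  have bE k : (k < n)%N -> sm_val _ (b k) = \sum_(j < m) A j k *: y j /\
      0 = \sum_(j < m) A j k *: w j.
    move=> kn; have := congr1 (sm_val D) (bc k kn); rewrite linear_sum => E.
    split; [apply: etrans (congr1 (@fst_lin R _ _) E) _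
           |apply: etrans (congr1 (@snd_lin R _ _) E) _];
    by rewrite linear_sum; apply: eq_bigr => j _; rewrite !linearZZ.
  have [|||q [C [CK Cgen]]] := @QF_right_noetherian_vectors R RQF m
      (fun v => forall k, (k < n)%N -> \sum_(j < m) A j k * v j = 0).
  - by move=> k _; rewrite big1 // => j _; rewrite mulr0.
  - move=> v v' v0 v'0 k kn; under eq_bigr => j _ do rewrite mulrBr.
    by rewrite sumrB v0 // v'0 // subr0.
  - move=> v s v0 k kn; under eq_bigr => j _ do rewrite mulrA.
    by rewrite -mulr_suml v0 // mul0r.
  (* At every index the entries of the [w j] solve the system, so they are combinations of the
     finitely many generators [C]; the coefficients form [q] families over [I]. *)
  have /choice[d dP] : forall i, exists d : nat -> R,
      forall j, (j < m)%N -> w j i = \sum_(l < q) C l j * d l.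
    move=> s; apply: Cgen => k kn; have [_ /(congr1 (fun v => v s))] := bE k kn.
    by rewrite fct_sumE.
  (* These families are lifted along [p]. Subtracting from [y j] the combination of the lifts given
     by [C] leaves a solution inside the kernel of [p], since each generator solves the homogeneous
     system. *)
  have /choice[z zP] : forall l, exists z, p z = f (fun i => d i l).
    by move=> l; apply: psurj.
  have wE j : (j < m)%N -> w j = \sum_(l < q) C l j *: (fun i => d i l : R^o).
    by move=> jm; apply/funext => s; rewrite dP // fct_sumE.
  have yz j : (j < m)%N -> ker_submodule p (y j - \sum_(l < q) C l j *: z l).
    move=> jm; rewrite /= linearB yw wE // (linear_sum f) (linear_sum p) -sumrB.
    rewrite big1 // => l _.
    by rewrite (linearZZ f) (linearZZ p) zP subrr.
  have /choice[c' c'P] : forall j, exists c', (j < m)%N ->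
      sm_val (ker_submodule p) c' = y j - \sum_(l < q) C l j *: z l.
    by move=> j; have [jm|_] := ltnP j m; [exists (sm_in (yz j jm))|exists 0].
  exists c' => k kn; apply: sm_val_inj; rewrite linear_sum.
  under eq_bigr => j _ do rewrite linearZZ c'P // scalerBr scaler_sumr.
  rewrite sumrB -(bE k kn).1 exchange_big [X in _ - X]big1 ?subr0 // => l _.
  under eq_bigr do rewrite scalerA.
  by rewrite -scaler_suml CK // scale0r.
(* The value at [w] is the first component of any [e] of the pullback over [w], minus its
   retraction; two choices of [e] differ by an element of the kernel, which [r] fixes. *)
have [|||g gP] := @choice_linear R (I -> R^o) M (fun w x => exists e,
    (sm_val D e).2 = w /\ x = (sm_val D e).1 - sm_val _ (r e)).
- move=> w; have [x px] := psurj (f w); have Dxw : D (x, w) by apply/DE.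
  by exists (x - sm_val _ (r (sm_in Dxw))), (sm_in Dxw).
- move=> a _ _ _ _ [e [<- ->]] [e' [<- ->]]; exists (a *: e + e').
  split; first by rewrite (linearP (sm_val D)).
  rewrite (linearP (sm_val D)) (linearP r) (linearP (sm_val _)) /=.
  by rewrite scalerBr opprD addrACA.
- move=> _ [e [e0 ->]]; have Dx : ker_submodule p (sm_val D e).1.
    by rewrite /= (DE _).1 ?e0 ?linear0 //; apply: sm_valP.
  rewrite (_ : e = i (sm_in Dx)) ?rP ?subrr //.
  by apply: sm_val_inj; apply: pair_eqP.
exists g => w; have [e [ew ->]] := (gP w _).2 erefl.
rewrite linearB (sm_valP (r e)) subr0 -ew; apply/DE/sm_valP.
Qed.

End QuasiFrobenius.

(** * The functor of the theorem *)

Section NaturalIso.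
Variables (C D : preadditive) (F G : functor C D).

(** The right adjoint of the theorem is determined up to such an isomorphism, along which the three
    properties are transported. *)
Definition natural_iso :=
  exists (t : forall x, hom (F x) (G x)) (u : forall x, hom (G x) (F x)),
  [/\ forall x, comp (u x) (t x) = idm _, forall x, comp (t x) (u x) = idm _
    & forall x y (f : hom x y), comp (t y) (fmap F f) = comp (fmap G f) (t x)].

Hypothesis FG : natural_iso.

Lemma full_natural_iso : full F -> full G.
Proof.
case: FG => t [u [ut tu nat]] fullF x y h.
have [f Ff] := fullF x y (comp (u y) (comp h (t x))); exists f.
by rewrite -[LHS]compm1 -(tu x) compA -nat Ff !compA tu comp1m -compA tu compm1.
Qed.

Lemma dense_natural_iso : dense F -> dense G.
Proof.
case: FG => t [u [ut tu nat]] denF y; have [x [f [g [gf fg]]]] := denF y.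
exists x, (comp f (u x)), (comp (t x) g); split.
  by rewrite -compA (compA g) gf comp1m tu.
by rewrite -compA (compA (u x)) ut comp1m fg.
Qed.

Lemma objective_natural_iso : objective F -> objective G.
Proof.
case: FG => t [u [ut tu nat]] objF x y h Gh0.
have [|K [a [b [K0 hE]]]] := objF x y h.
  by rewrite -[LHS]comp1m -(ut y) -compA nat Gh0 comp0m compm0.
exists K, a, b; split=> // z; split=> f.
  by rewrite -[f]compm1 -(tu K) compA ((K0 _).1 (comp f (t K))) comp0m.
by rewrite -[f]comp1m -(tu K) -compA ((K0 _).2 (comp (u K) f)) compm0.
Qed.

End NaturalIso.

(** The comparison maps are the counit of each adjunction transposed by the other. *)
Lemma right_adjoint_unique (C D : preadditive) (F : functor C D) (G G' : functor D C) :
  right_adjoint F G -> right_adjoint F G' -> natural_iso G G'.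
Proof.
move=> [phi [bij phiF phiG]] [phi' [bij' phi'F phi'G]].
have [psi psiP] : exists psi : forall c d, hom c (G d) -> hom (F c) d,
    forall c d, cancel (@phi c d) (@psi c d) /\ cancel (@psi c d) (@phi c d).
  have inv c d : exists psi, cancel (@phi c d) psi /\ cancel psi (@phi c d).
    by have [k] := bij c d; exists k.
  exists (fun c d => projT1 (cid (inv c d))) => c d; exact: (projT2 (cid (inv c d))).
have [psi' psi'P] : exists psi : forall c d, hom c (G' d) -> hom (F c) d,
    forall c d, cancel (@phi' c d) (@psi c d) /\ cancel (@psi c d) (@phi' c d).
  have inv c d : exists psi, cancel (@phi' c d) psi /\ cancel psi (@phi' c d).
    by have [k] := bij' c d; exists k.
  exists (fun c d => projT1 (cid (inv c d))) => c d; exact: (projT2 (cid (inv c d))).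
have psiF c d (f : hom c (G d)) : comp (psi _ _ (idm (G d))) (fmap F f) = psi _ _ f.
  by rewrite -[LHS](psiP _ _).1 phiF (psiP _ _).2 comp1m.
have psi'F c d (f : hom c (G' d)) :
    comp (psi' _ _ (idm (G' d))) (fmap F f) = psi' _ _ f.
  by rewrite -[LHS](psi'P _ _).1 phi'F (psi'P _ _).2 comp1m.
exists (fun d => phi' _ _ (psi _ _ (idm (G d)))),
  (fun d => phi _ _ (psi' _ _ (idm (G' d)))).
split=> [d|d|d d' f].
- by rewrite -phiF psi'F (psi'P _ _).1 (psiP _ _).2.
- by rewrite -phi'F psiF (psiP _ _).1 (psi'P _ _).2.
rewrite -phi'F psiF -phi'G; congr phi'.
by rewrite -[LHS](psiP _ _).1 -[RHS](psiP _ _).1 phiG !(psiP _ _).2 compm1.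
Qed.

Lemma comp_natural_iso (C D E : preadditive) (H : functor C D) (G G' : functor D E) :
  natural_iso G G' -> natural_iso (comp_functor G H) (comp_functor G' H).
Proof.
case=> t [u [ut tu nat]]; exists (fun x => t (H x)), (fun x => u (H x)).
by split=> [x|x|x y f]; [apply: ut|apply: tu|apply: nat].
Qed.

Lemma nat_trans_bij_iso (C : preadditive) (F G : functor C Ab) (t : nat_trans F G) :
  (forall x a, t x a = 0 -> a = 0) -> (forall x b, exists a, t x a = b) ->
  exists u : nat_trans G F, nat_comp u t = nat_id F /\ nat_comp t u = nat_id G.
Proof.
move=> t0 tsurj.
have tinj x a a' : t x a = t x a' -> a = a'.
  move=> taa; apply/eqP; rewrite -subr_eq0; apply/eqP/t0.
  by rewrite raddfB taa subrr.
pose v x b := projT1 (cid (tsurj x b)).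
have tv x b : t x (v x b) = b := projT2 (cid (tsurj x b)).
have v_add x : zmod_morphism (v x) by move=> b b'; apply: tinj; rewrite raddfB !tv.
have v_nat x y (f : hom x y) :
    comp (mk_additive (@v_add y) : hom (G y) (F y)) (fmap G f) =
    comp (fmap F f) (mk_additive (@v_add x) : hom (G x) (F x)).
  apply: additive_eq => b; apply: tinj => /=; rewrite tv.
  have := congr1 (fun k : {additive _ -> _} => k (v x b)) (ntr_nat t f).
  by rewrite /= tv.
exists (NatTrans v_nat); split; apply: nat_trans_eq => x; apply: additive_eq => a.
  by apply: tinj; rewrite /= tv.
exact: tv.
Qed.

Lemma regular_projective (R : pzRingType) :
  projective_module (fpmod_sort (regular R)).
Proof.
move=> A B p f psurj; pose S := opring R.
have [a pa] := psurj (f (1 : S)).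
have g_lin : linear (fun r : S^o => (r : S) *: a).
  by move=> r s s'; rewrite scalerDl scalerA.
exists (mk_linear g_lin) => r /=.
by rewrite (linearZZ p) pa -(linearZZ f) -[_ *: _]/(_ * _) mulr1.
Qed.

(** [P] is a retract of a free module of finite rank, over which a tensor vanishes when its
    coefficients do; [f] detects the latter. *)
Lemma projective_flat (R : pzRingType) (P : fpmod R) (M N : lmodType R)
    (f : {linear M -> N}) :
  projective_module (fpmod_sort P) -> injective f ->
  forall t, tmapr (fpmod_sort P) f t = 0 -> t = 0.
Proof.
move=> projP finj t ft0.
have [n [m [x [A prP]]]] := presentation_fp (svalP P).
(* Without relations the cokernel is free on n generators. *)
have [Q [q [_ prQ]]] := presentation_coker n 0 (fun _ _ => 0 : R).
have [//|p pE] := @presentation_hom _ _ (fpmod_sort P) _ _ _ _ x prQ.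
have [w|s sP] := projP _ _ p idfun.
  have [v ->] := prP.1 w; exists (\sum_(i < n) (v i : opring R) *: q i).
  by rewrite linear_sum; apply: eq_bigr => i _; rewrite linearZZ pE.
suff s0 : tmapl M s t = 0.
  rewrite -[t]tmapl_id -(tmapl_ext _ (f := p \o s : {linear _ -> _})) //.
  by rewrite -tmapl_comp s0 raddf0.
have [b sE] := presentation_tens (tmapl M s t) prQ.
have : tmapr Q f (tmapl M s t) = 0 by rewrite -tmaplr ft0 raddf0.
rewrite sE raddf_sum /=; under eq_bigr do rewrite tmaprE.
move/(presentation_tens_eq0 (fun i => f (b i)) prQ) => [c fb].
rewrite big1 // => i _; rewrite (_ : b i = 0) ?tens0r //.
by apply: finj; rewrite linear0 fb // big_ord0.
Qed.

Lemma val_subfunctor (C : preadditive) (F : functor C Ab) S SF (x y : C) (f : hom x y)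
  (t : @subfunctor C F S SF x) : val (fmap (subfunctor SF) f t) = fmap F f (val t).
Proof. by []. Qed.

Lemma nat_trans_app (C : preadditive) (F G : functor C Ab) (a : nat_trans F G)
  (x y : C) (f : hom x y) t : a y (fmap F f t) = fmap G f (a x t).
Proof. exact: (congr1 (fun k : {additive _ -> _} => k t) (ntr_nat a f)). Qed.

Lemma val_stable_part_mor (R : pzRingType) (F G : functor (fpmod R) Ab)
  (a : nat_trans F G) X t : val (stable_part_mor a X t) = a X (val t).
Proof. by []. Qed.

Lemma val_ker_mor (C : preadditive) (a b : mor_cat (functor_cat C Ab)) (s : hom a b)
  X t : val (ker_mor s X t) = sq_src s X (val t).
Proof. by []. Qed.

(** * Fullness, objectivity and density for the explicit coreflection *)

Section Main.
Variable R : pzRingType.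
Hypothesis RQF : quasi_frobenius R.
Hypothesis Rpss : left_pure_semisimple R.

Local Notation Epi := (epi_cat (Mod R)).
Let Y (g : Epi) : lmodType R := src (sval g).
Let Z (g : Epi) : lmodType R := tgt (sval g).
Let mor (g : Epi) : {linear Y g -> Z g} := arr (sval g).

Let mor_surj (g : Epi) : forall z, exists y, mor g y = z.
Proof. by apply/epi_surj; apply: (svalP g). Qed.

Let Im : functor Epi (stable_Ab R) := Im_functor (stable_coreflection R).

Let Imf (g : Epi) : functor (fpmod R) Ab :=
  stable_part_functor (ker_obj (mor_map (tensor_functor R) (sval g))).

Let el (g : Epi) (X : fpmod R) (t : Imf g X) : tensor (fpmod_sort X) (Y g) :=
  val (val t).

Let elB g X (t t' : Imf g X) : el (t - t') = el t - el t'.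
Proof. by rewrite /el !raddfB. Qed.

Let el0 g X : el (0 : Imf g X) = 0.
Proof. by rewrite /el !raddf0. Qed.

Let el_inj g X : injective (@el g X).
Proof. by move=> t t' tt'; apply: val_inj; apply: val_inj. Qed.

(** Membership in the kernel and in its largest subfunctor vanishing on projectives, unfolded for
    the underlying tensors. *)
Let in_Im (g : Epi) (X : fpmod R) (u : tensor (fpmod_sort X) (Y g)) :=
  tmapr _ (mor g) u = 0 /\
  forall (P : fpmod R) (h : {linear fpmod_sort X -> fpmod_sort P}),
    projective_module (fpmod_sort P) -> tmapl _ h u = 0.

Let elP g X (t : Imf g X) : in_Im (el t).
Proof.
split=> [|P h projP]; first exact: (sg_valS (val t)).
exact: (congr1 val (sg_valS t P h projP)).
Qed.

Let el_surj g X (u : tensor (fpmod_sort X) (Y g)) :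
  in_Im u -> exists t : Imf g X, el t = u.
Proof.
move=> [gu hu].
pose v : ker_obj (mor_map (tensor_functor R) (sval g)) X :=
  @sg_in _ (ker_subgroup (tmapr (fpmod_sort X) (mor g))) u gu.
have vs : stable_part (ker_obj (mor_map (tensor_functor R) (sval g))) X v.
  by move=> P h projP; apply: val_inj; apply: hu.
by exists (sg_in vs).
Qed.

Let el_fmap g (X X' : fpmod R) (h : hom X X') (t : Imf g X) :
  el (fmap (Imf g) h t) = tmapl _ (h : {linear _ -> _}) (el t).
Proof.
rewrite /el.
exact: etrans (congr1 val (val_subfunctor h t)) (val_subfunctor h (val t)).
Qed.

Let Imm (g g' : Epi) (s : hom g g') : nat_trans (Imf g) (Imf g') :=
  stable_part_mor (ker_mor (fmap (mor_map (tensor_functor R))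
    (s : hom (sval g) (sval g')))).

Let el_Im g g' (s : hom g g') (X : fpmod R) (t : Imf g X) :
  el (Imm s X t) = tmapr _ (sq_src s : {linear _ -> _}) (el t).
Proof.
rewrite /el /Imm.
rewrite val_stable_part_mor.
rewrite val_ker_mor.
by [].
Qed.

Let ImE g g' (s : hom g g') : fmap Im s = Imm s.
Proof. by []. Qed.

Let Im0E g g' : hom0 (Im g) (Im g') = nat_0 (Imf g) (Imf g').
Proof. by []. Qed.
(* The [s : Y -> I] of the paper.                                             *)
Let I (g : Epi) : lmodType R := ({linear Y g -> R^o} -> R^o).

Fact biduality_is_linear g : linear (fun (y : Y g) => (fun f => f y) : I g).
Proof. by move=> a y y'; apply/funext => f; rewrite linearP. Qed.
Let s (g : Epi) : {linear Y g -> I g} := mk_linear (@biduality_is_linear g).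

Let s_inj g : injective (s g).
Proof.
move=> y y' yy'; apply/eqP; rewrite -subr_eq0; apply/eqP.
apply: (QF_cogenerator_left RQF) => f; rewrite linearB.
by rewrite (congr1 (fun w => w f) yy' : f y = f y') subrr.
Qed.

Let gs (g : Epi) : {linear Y g -> (Z g * I g)%type} := pair_lin (mor g) (s g).

Let separated_eq0 (N : lmodType R) (X : fpmod R) (t : tensor (fpmod_sort X) N) :
  separated N ->
  (forall (P : fpmod R) (h : {linear fpmod_sort X -> fpmod_sort P}),
    projective_module (fpmod_sort P) -> tmapl _ h t = 0) -> t = 0.
Proof.
move=> sepN ht; apply: sepN (svalP X) _ _ => h.
exact: (ht (regular R) h (@regular_projective R)).
Qed.

(** If [u] dies under all maps to projectives, so does its image in X tensor I, which is then 0
    because I is separated. Conversely, if [s g] kills [u], then so does every map from X to a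
    projective P, because P is flat and [s g] is injective. *)
Let in_Im_ker g X (u : tensor (fpmod_sort X) (Y g)) : in_Im u <-> tmapr _ (gs g) u = 0.
Proof.
have fst_gs : tmapr _ (fst_lin _ _) (tmapr _ (gs g) u) = tmapr _ (mor g) u.
  by rewrite tmapr_comp; apply: tmapr_ext.
have snd_gs : tmapr _ (snd_lin _ _) (tmapr _ (gs g) u) = tmapr _ (s g) u.
  by rewrite tmapr_comp; apply: tmapr_ext.
split=> [[gu hu]|u0].
  apply: tmapr_pair_eq0; rewrite ?fst_gs // snd_gs.
  apply: (separated_eq0 (@separated_product R RQF _)) => P h projP.
  by rewrite tmaplr hu // raddf0.
split=> [|P h projP]; first by rewrite -fst_gs u0 raddf0.
apply: (projective_flat projP (@s_inj g)).
by rewrite -tmaplr -snd_gs u0 !raddf0.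
Qed.

Lemma full_Im : full Im.
Proof.
move=> g g' h.
pose hn : nat_trans (Imf g) (Imf g') := h.
pose hX (X : fpmod R) : {additive Imf g X -> Imf g' X} := hn X.
pose graph (X : fpmod R) (z : tensor (fpmod_sort X) (Y g * Y g')%type) :=
  exists t : Imf g X,
    tmapr _ (fst_lin _ _) z = el t /\ tmapr _ (snd_lin _ _) z = el (hX X t).
have graph0 X : graph X 0.
  by exists 0; split; rewrite ?(raddf0 (hX X)) el0 (raddf0 (tmapr _ _)).
have graphB X z z' : graph X z -> graph X z' -> graph X (z - z').
  move=> [t [z1 z2]] [t' [z'1 z'2]]; exists (t - t').
  split; first by rewrite (raddfB (tmapr _ _)) z1 z'1 -elB.
  by rewrite (raddfB (tmapr _ _)) z2 z'2 -elB -(raddfB (hX X)).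
have [X X' f z [t [z1 z2]]|X z [t [z1 z2]] z0|f fP] := @graph_extend R Rpss (Y g) (Y g')
    (fun X => Subgroup (graph0 X) (graphB X)).
- exists (fmap (Imf g) (f : hom X X') t); split.
    by rewrite -[LHS]tmaplr z1 -(el_fmap (f : hom X X')).
  rewrite -[LHS]tmaplr z2 /hX (nat_trans_app hn (f : hom X X') t).
  exact/esym/(el_fmap (f : hom X X')).
- rewrite z2 (_ : t = 0) ?raddf0 //.
  by apply: el_inj; rewrite -z1 z0.
have fE X (t : Imf g X) : tmapr _ f (el t) = el (hX X t).
  have [z [z1 z2]] := tmapr_pair_exists (el t) (el (hX X t)).
  by rewrite -z2 -z1; apply/esym/fP; exists t.
(* The kernel of [gs g] is Im(g), which [f] sends into Im(g'), and [mor g'] kills the latter. *)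
have [X t t0|c cP] := tensor_factor Rpss (k := gs g)
    (k' := mor g' \o f : {linear _ -> _}).
  have [w <-] := el_surj ((in_Im_ker t).2 t0).
  rewrite -tmapr_comp fE.
  by have [] := elP (hX _ w).
(* The component of [c] on I is the obstruction to [f] lying over a map Z -> Z'; its lift along
   [mor g'], composed with [s g], is subtracted from [f]. *)
have [l lP] := product_lift RQF Rpss
  (c \o inr_lin (Z g) (I g) : {linear _ -> _}) (@mor_surj g').
pose ls : {linear Y g -> Y g'} := l \o s g.
pose f' : {linear Y g -> Y g'} := f \- ls.
pose d : {linear Z g -> Z g'} := c \o inl_lin (Z g) (I g).
have sq : comp (d : hom (Z g : Mod R) (Z g')) (mor g) =
          comp (mor g' : hom (Y g' : Mod R) _) f'.
  apply: linear_eq => y.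
  rewrite -[RHS]/(mor g' (f y - l (s g y))) linearB lP (cP y : mor g' (f y) = _).
  rewrite -[RHS](linearB c) /=; congr (c _).
  by apply: pair_eqP; rewrite /= ?subr0 ?subrr.
(* The correction factors through [s g], which vanishes on Im(g), so the induced transformation is
   unchanged. *)
have f't X (t : Imf g X) : tmapr _ f' (el t) = el (hX X t).
  have st : tmapr _ (s g) (el t) = 0.
    have -> : tmapr _ (s g) (el t) = tmapr _ (snd_lin _ _) (tmapr _ (gs g) (el t)).
      by rewrite tmapr_comp; apply: tmapr_ext.
    by rewrite ((in_Im_ker (el t)).1 (elP t)) raddf0.
  have ls0 : tmapr _ ls (el t) = 0.
    have -> : tmapr _ ls (el t) = tmapr _ l (tmapr _ (s g) (el t)).
      by rewrite tmapr_comp; apply: tmapr_ext.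
    by rewrite st raddf0.
  by rewrite tmaprB fE ls0 subr0.
pose q : hom g g' := Square sq.
have qE X (t : Imf g X) : Imm q X t = hX X t.
  by apply: el_inj; rewrite (el_Im q t) -f't.
exists q; rewrite ImE.
apply: (@nat_trans_eq _ _ (Imf g) (Imf g') (Imm q) hn) => X.
exact: additive_eq (qE X).
Qed.

Lemma objective_Im : objective Im.
Proof.
move=> g g' h h0.
pose f : {linear Y g -> Y g'} := sq_src h; pose f' : {linear Z g -> Z g'} := sq_tgt h.
have hE y : f' (mor g y) = mor g' (f y).
  exact: (congr1 (fun k : {linear _ -> _} => k y) (sq_comm h)).
have f0 X (t : Imf g X) : tmapr _ f (el t) = 0.
  have Imm0 : Imm h = nat_0 (Imf g) (Imf g') :=
    etrans (esym (ImE h)) (etrans h0 (Im0E g g')).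
  by rewrite -[LHS]el_Im Imm0.
have [X t t0|c cP] := tensor_factor Rpss (k := gs g) (k' := f).
  have [w <-] := el_surj ((in_Im_ker t).2 t0).
  exact: f0.
(* [D] is the image under [gs g] of the kernel of [mor g], so the quotient by it is the pushout of
   [gs g] along the surjection [mor g]. *)
pose D := im_submodule (inr_lin (Z g) (I g) \o (s g \o sm_val (ker_submodule (mor g)))).
have DE y : mor g y = 0 -> sm_pi D (gs g y) = 0.
  move=> gy; apply/sm_pi_eq0; exists (sm_in (S := ker_submodule (mor g)) gy).
  by apply: pair_eqP.
have epi_pi : is_epi (sm_pi D : hom ((Z g * I g)%type : Mod R) (sm_quot D)).
  by apply/epi_surj; apply: sm_pi_surj.
pose K : Epi := exist _ (@Arrow (Mod R) _ _ (sm_pi D)) epi_pi.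
have [//|b bP] := linear_lift (p := mor g)
    (f := sm_pi D \o gs g : {linear _ -> _}) (@mor_surj g).
have [w /sm_pi_eq0[y <-]|b' b'P] := linear_lift (p := sm_pi D)
    (f := mor g' \o c : {linear _ -> _}) (@sm_pi_surj _ _ D).
  have gy : mor g (sm_val _ y) = 0 := sm_valP y.
  rewrite /= (_ : (_, _) = gs g (sm_val _ y)) -?cP -?hE ?gy ?linear0 //.
  by apply: pair_eqP.
have sqa : comp (b : hom (Z g : Mod R) (sm_quot D)) (mor g) =
    comp (sm_pi D : hom ((Z g * I g)%type : Mod R) (sm_quot D)) (gs g).
  by apply: linear_eq => y; apply: bP.
have sqb : comp (b' : hom (sm_quot D : Mod R) (Z g')) (sm_pi D) =
    comp (mor g' : hom (Y g' : Mod R) _) (c : hom ((Z g * I g)%type : Mod R) _).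
  by apply: linear_eq => y; apply: b'P.
exists K, (@Square _ (sval g) (sval K) _ _ sqa),
  (@Square _ (sval K) (sval g') _ _ sqb); split.
  (* [D] lies in the summand I, so the projection to Z factors through the quotient and elements of
     Im(K) have zero Z component; their I component is 0 because I is separated. *)
  have [w /sm_pi_eq0[y <-]|q qP] := linear_lift (p := sm_pi D)
    (f := fst_lin (Z g) (I g)) (@sm_pi_surj _ _ D).
    by [].
  have fst0 X (w : tensor X (Z g * I g)%type) :
      tmapr X (sm_pi D) w = 0 -> tmapr X (fst_lin _ _) w = 0.
    move=> pw; rewrite (_ : tmapr _ _ _ = tmapr X q (tmapr X (sm_pi D) w)).
      by rewrite pw raddf0.
    by rewrite tmapr_comp; apply: tmapr_ext => y; exact: esym (qP y).
  have snd0 (X : fpmod R) (w : tensor (fpmod_sort X) (Z g * I g)%type) :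
      (forall (P : fpmod R) (k : {linear fpmod_sort X -> fpmod_sort P}),
        projective_module (fpmod_sort P) -> tmapl _ k w = 0) ->
      tmapr _ (snd_lin _ _) w = 0.
    move=> kw; apply: (separated_eq0 (@separated_product R RQF _)) => P k projP.
    by rewrite tmaplr kw // raddf0.
  have K0 X (t : Imf K X) : t = 0.
    have [pt ht] := elP t; apply: el_inj; rewrite el0.
    by apply: tmapr_pair_eq0; [apply: fst0 pt|apply: snd0 ht].
  move=> H; split=> k; apply: nat_trans_eq => X; apply: additive_eq => t.
    by rewrite (K0 X t) !raddf0.
  exact: K0.
have fE : (f : hom (Y g : Mod R) (Y g')) =
    comp (c : hom ((Z g * I g)%type : Mod R) (Y g')) (gs g).
  by apply: linear_eq => y; apply: cP.
have f'E : (f' : hom (Z g : Mod R) (Z g')) = comp (b' : hom (sm_quot D : Mod R) _) b.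
  apply: linear_eq => z; have [y <-] := mor_surj z.
  exact: etrans (hE y) (etrans (congr1 (mor g') (cP y))
    (esym (etrans (congr1 b' (bP y)) (b'P _)))).
by apply: square_eq; [apply: fE|apply: f'E].
Qed.

Lemma dense_Im : dense Im.
Proof.
move=> F; have [B [e [e0 e_nat]]] := functor_embedding (sval F).
pose L (X : fpmod R) (u : tensor (fpmod_sort X) B) := exists a, e X a = u.
have L0 X : L X 0 by exists 0; rewrite raddf0.
have LB X u u' : L X u -> L X u' -> L X (u - u').
  by move=> [a <-] [a' <-]; exists (a - a'); rewrite raddfB.
have [X X' h u [a <-]|N [f fL]] := subfunctor_kernel
    (L := fun X => Subgroup (L0 X) (LB X)).
  by exists (fmap (sval F) (h : hom X X') a); rewrite e_nat.
(* The free summand makes the map onto; being separated, it contributes nothing to the stable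
   part. *)
pose p := copair_lin f (free_cover_map N).
have epi_p : is_epi (p : hom ((B * free_cover N)%type : Mod R) N).
  apply/epi_surj => n; have [x <-] := free_cover_surj n.
  by exists (0, x); rewrite /= linear0 add0r.
pose g : Epi := exist _ (@Arrow (Mod R) _ _ p) epi_p.
have pE X (z : tensor (fpmod_sort X) (B * free_cover N)%type) :
    tmapr _ (snd_lin _ _) z = 0 -> tmapr _ p z = tmapr _ f (tmapr _ (fst_lin _ _) z).
  move=> z2; rewrite {1}(tmapr_pairE z) z2 raddf0 addr0 !tmapr_comp.
  apply: tmapr_ext => x; rewrite -[LHS]/(f x.1 + free_cover_map N 0).
  by rewrite linear0 addr0.
pose i X : {additive sval F X -> tensor (fpmod_sort X) (B * free_cover N)%type} :=
  tmapr _ (inl_lin B (free_cover N)) \o e X.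
have i1 X a : tmapr _ (fst_lin _ _) (i X a) = e X a.
  by rewrite /= tmapr_comp -[RHS]tmapr_id; apply: tmapr_ext.
have i2 X a : tmapr _ (snd_lin _ _) (i X a) = 0.
  by rewrite /= tmapr_comp -(tmapr0 _ (e X a)); apply: tmapr_ext.
have i_nat (X X' : fpmod R) (h : hom X X') a :
    i X' (fmap (sval F) h a) = tmapl _ (h : {linear _ -> _}) (i X a).
  by rewrite /= e_nat tmaplr.
have in_Im_i X a : @in_Im g X (i X a).
  split=> [|P h projP].
    by rewrite [LHS](pE X) // i1; apply/fL; exists a.
  rewrite -(i_nat X P h) (_ : fmap (sval F) _ a = 0) ?raddf0 //.
  have [_ /(_ (idm _)) id0] := svalP F P projP (sval F P).
  exact: (congr1 (fun k : {additive _ -> _} => k (fmap (sval F) (h : hom X P) a)) id0).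
pose t X (a : sval F X) : Imf g X := projT1 (cid (el_surj (in_Im_i X a))).
have tE X a : el (t X a) = i X a := projT2 (cid (el_surj (in_Im_i X a))).
have t_add X : zmod_morphism (t X).
  move=> a a'; apply: el_inj.
  by rewrite elB !tE raddfB.
have t_nat (X X' : fpmod R) (h : hom X X') :
    comp (mk_additive (t_add X') : hom (sval F X') (Imf g X')) (fmap (sval F) h) =
    comp (fmap (Imf g) h) (mk_additive (t_add X) : hom (sval F X) (Imf g X)).
  by apply: additive_eq => a; apply: el_inj; rewrite el_fmap /= !tE i_nat.
have [X a /= ta0|X w|u [ut tu]] := nat_trans_bij_iso (t := NatTrans t_nat).
- by apply: e0; rewrite -i1 -tE ta0 !raddf0.
- have [pw hw] := elP w.
  (* As the free component of [el w] vanishes, its component in [B] is killed by [f] and so comes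
     from [F]. *)
  have w2 : tmapr _ (snd_lin _ _) (el w) = 0.
    apply: (separated_eq0 (@separated_free_cover R RQF _)) => P h projP.
    by rewrite tmaplr hw // raddf0.
  have /fL[a ea] : tmapr _ f (tmapr _ (fst_lin _ _) (el w)) = 0 by rewrite -pE.
  exists a; apply: el_inj; rewrite /= tE [el w]tmapr_pairE w2 raddf0 addr0.
  by rewrite -ea.
by exists g, u; exists (NatTrans t_nat).
Qed.

End Main.

Theorem theorem6p8 (R : pzRingType)
    (jrho : functor (fpmod_Ab R) (stable_Ab R))
    (jrhoP : right_adjoint (stable_incl R) jrho)
    (Rpss : left_pure_semisimple R)
    (RQF : quasi_frobenius R) :
  full (Im_functor jrho) /\ dense (Im_functor jrho) /\
  objective (Im_functor jrho).
Proof.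
have iso : natural_iso (Im_functor (stable_coreflection R)) (Im_functor jrho).
  by apply/comp_natural_iso/right_adjoint_unique/jrhoP/stable_coreflectionP.
split; first exact: full_natural_iso iso (full_Im RQF Rpss).
split; first exact: dense_natural_iso iso (dense_Im RQF).
exact: objective_natural_iso iso (objective_Im RQF Rpss).
Qed.
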